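(* Let $X_{ij}$, $j=1,2,\dots$, $i=1,2$, be two independent i.i.d. samples of random variables with common mean $\mu$, variances $\sigma_1^2,\sigma_2^2$, and $E|X_{i1}|^{12}<\infty$, $i=1,2$. Let $\widehat\mu_N(\gamma)$ be the common mean estimator with random weights defined in the context, and let $\sigma_\mu^2$ be its asymptotic variance given there. Let $\tau_a$, $a>0$, be a family of integer-valued random variables with $\tau_a/a\to c$ in probability as $a\to\infty$, for a constant $0<c<\infty$. Then $\sqrt N(\widehat\mu_N(\gamma)-\mu)/\sigma_\mu$ satisfies the random central limit theorem, i.e. $$\sqrt{\tau_a}\,(\widehat\mu_{\tau_a}(\gamma)-\mu)/\sigma_\mu\to N(0,1)\quad\text{in distribution, as }a\to\infty.$$ Consequently the following condition (A) holds for $\widehat\mu_n=\widehat\mu_n(\gamma)$: for any family $\{N_a:a>0\}$ of stopping times with $N_a/a\to k$ in probability, $0<k<\infty$, one has $\sqrt{N_a}(\widehat\mu_{N_a}-\mu)/\sigma_\mu\to N(0,1)$ in distribution as $a\to\infty$.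
   Context: For sample size $N$ (equal for both samples), $\overline X_i=\frac1N\sum_{j=1}^N X_{ij}$ is the $i$th sample mean and $\widetilde S_i^2=\frac1{N-1}\sum_{j=1}^N(X_{ij}-\overline X_i)^2$ the unbiased sample variance, $i=1,2$. The common mean estimator is $$\widehat\mu_N(\gamma)=\gamma_N\overline X_1+(1-\gamma_N)\overline X_2,\qquad \gamma_N=\gamma(\widetilde S_1^2,\widetilde S_2^2,\overline X_1,\overline X_2)=\begin{cases}\gamma^{\le}(\widetilde S_1^2,\widetilde S_2^2,\overline X_1,\overline X_2),&\widetilde S_1^2\le\widetilde S_2^2,\\ \gamma^{>}(\widetilde S_1^2,\widetilde S_2^2,\overline X_1,\overline X_2),&\widetilde S_1^2>\widetilde S_2^2,\end{cases}$$ where the functions $\gamma^{\le}$ and $\gamma^{>}$ are three times continuously differentiable with bounded derivatives. The asymptotic variance in $\sqrt N(\widehat\mu_N(\gamma)-\mu)\to N(0,\sigma_\mu^2)$ (in distribution, as $N\to\infty$) is given as $$\sigma_\mu^2=2\,[\gamma^2\sigma_1^2+(1-\gamma)^2\sigma_2^2],\qquad \gamma=\gamma(\sigma_1^2,\sigma_2^2,\mu,\mu).$$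
   Formalization: The asymptotic variance is taken as γ²σ₁²+(1−γ)²σ₂², without the factor 2, which is wrong for normalization by √N; if σ₁²=σ₂², then γ^≤ and γ^> are assumed to agree at (σ₁²,σ₂²,μ,μ), since otherwise the limit can be a non-normal mixture; σ_μ>0 is assumed. *)

(* Defs.v *)
From HB Require Import structures.
From mathcomp Require Import all_boot all_order all_algebra.
From mathcomp Require Import all_classical all_reals all_analysis.

Set Implicit Arguments.
Unset Strict Implicit.
Unset Printing Implicit Defensive.

Import Order.TTheory GRing.Theory Num.Theory.
Import numFieldNormedType.Exports.

Local Open Scope classical_set_scope.
Local Open Scope ring_scope.

Section Smoothness.
Context {R : realType} {n : nat}.
Implicit Types f : 'rV[R]_n.+1 -> R.

Definition partial (i : 'I_n.+1) f : 'rV[R]_n.+1 -> R :=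
  fun x => 'D_(delta_mx 0 i) f x.

Fixpoint cont_diff (k : nat) f : Prop :=
  continuous f /\
  match k with
  | 0 => True
  | k'.+1 => forall i, (forall x, derivable f x (delta_mx 0 i)) /\
                       cont_diff k' (partial i f)
  end.

(* All partial derivatives of orders 1, ..., k are bounded; the function itself
   (order 0) need not be. *)
Fixpoint bounded_derivatives (k : nat) f : Prop :=
  match k with
  | 0 => True
  | k'.+1 => forall i, [bounded partial i f x | x in [set: 'rV[R]_n.+1]] /\
                       bounded_derivatives k' (partial i f)
  end.

End Smoothness.

Section Probability.
Context {d : measure_display} {T : measurableType d} {R : realType}.
Variable P : probability T R.

Definition mutually_independent (I : eqType) (X : I -> {RV P >-> R}) : Prop :=
  forall (s : seq I) (A : I -> set R), uniq s ->
    (forall i, measurable (A i)) ->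
    P (\bigcap_(i in [set` s]) (X i @^-1` A i)) =
    (\prod_(i <- s) P (X i @^-1` A i))%E.

Definition identically_distributed (X : nat -> {RV P >-> R}) : Prop :=
  forall j (A : set R), measurable A ->
    distribution P (X j) A = distribution P (X 0) A.

(* For families indexed by a real parameter a, as a tends to +oo. *)
Definition cvg_in_probability (Y : R -> T -> R) (c : R) : Prop :=
  forall e : R, 0 < e ->
    P [set w | e <= `|Y a w - c|] @[a --> +oo] --> 0%E.

(* Convergence of the distribution functions at every continuity point of the
   limiting distribution function, as a tends to +oo. *)
Definition cvg_in_distribution (Y : R -> T -> R) (Q : set R -> \bar R) : Prop :=
  forall x : R, Q [set x] = 0%E ->
    P [set w | Y a w <= x] @[a --> +oo] --> Q [set` `]-oo, x]].

Definition integer_rv (tau : T -> int) : Prop :=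
  forall k : int, measurable [set w | tau w = k].

Definition filtration (F : nat -> set (set T)) : Prop :=
  [/\ forall n, sigma_algebra setT (F n),
      forall n, F n `<=` measurable
    & forall m n, (m <= n)%N -> F m `<=` F n].

Definition stopping_time (F : nat -> set (set T)) (N : T -> nat) : Prop :=
  forall n, F n [set w | (N w <= n)%N].

(* Num.sqrt vanishes on negative numbers, so that the statistic is 0 on the
   event tau a <= 0, whose probability tends to 0. *)
Definition random_clt (est : nat -> T -> R) (mu sigma : R) : Prop :=
  forall (c : R) (tau : R -> T -> int),
    0 < c ->
    (forall a, 0 < a -> integer_rv (tau a)) ->
    cvg_in_probability (fun a w => (tau a w)%:~R / a) c ->
    cvg_in_distribution
      (fun a w => Num.sqrt (tau a w)%:~R *
                  (est (absz (tau a w)) w - mu) / sigma)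
      (normal_prob 0 1).

Definition condition_A (est : nat -> T -> R) (mu sigma : R) : Prop :=
  forall (F : nat -> set (set T)) (k : R) (N : R -> T -> nat),
    filtration F ->
    0 < k ->
    (forall a, 0 < a -> stopping_time F (N a)) ->
    cvg_in_probability (fun a w => (N a w)%:R / a) k ->
    cvg_in_distribution
      (fun a w => Num.sqrt (N a w)%:R * (est (N a w) w - mu) / sigma)
      (normal_prob 0 1).

End Probability.

Section CommonMean.
Context {R : realType}.

Definition row4 (s1 s2 x1 x2 : R) : 'rV[R]_4 :=
  \row_(i < 4) [:: s1; s2; x1; x2]`_i.

Definition weight (gle ggt : 'rV[R]_4 -> R) (s1 s2 x1 x2 : R) : R :=
  if s1 <= s2 then gle (row4 s1 s2 x1 x2) else ggt (row4 s1 s2 x1 x2).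

(* Variance of the normal limit of sqrt N * (common_mean N - mu), where N is the
   size of each of the two samples.  It is often written as
   2 * (g ^+ 2 * sigma1 ^+ 2 + (1 - g) ^+ 2 * sigma2 ^+ 2): the factor 2 belongs
   to the normalization by the square root of the total number 2 * N of
   observations, and would be wrong here. *)
Definition asymptotic_variance (gle ggt : 'rV[R]_4 -> R)
    (mu sigma1 sigma2 : R) : R :=
  let g := weight gle ggt (sigma1 ^+ 2) (sigma2 ^+ 2) mu mu in
  g ^+ 2 * sigma1 ^+ 2 + (1 - g) ^+ 2 * sigma2 ^+ 2.

Context {T : Type}.

(* Observations are numbered from 0: the sample of size N consists of
   X 0, ..., X N.-1. *)
Definition sample_mean (X : nat -> T -> R) (N : nat) (w : T) : R :=
  N%:R^-1 * \sum_(j < N) X j w.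

Definition sample_variance (X : nat -> T -> R) (N : nat) (w : T) : R :=
  (N.-1)%:R^-1 * \sum_(j < N) (X j w - sample_mean X N w) ^+ 2.

Definition common_mean (gle ggt : 'rV[R]_4 -> R) (X1 X2 : nat -> T -> R)
    (N : nat) (w : T) : R :=
  let g := weight gle ggt (sample_variance X1 N w) (sample_variance X2 N w)
                          (sample_mean X1 N w) (sample_mean X2 N w) in
  g * sample_mean X1 N w + (1 - g) * sample_mean X2 N w.

End CommonMean.

(* Main.v *)
Require Import Defs.
From HB Require Import structures.
From mathcomp Require Import all_boot all_order all_algebra.
From mathcomp Require Import all_classical all_reals all_analysis.
From mathcomp Require Import measurable_realfun.
From mathcomp Require Import ring lra.

(* Let g be the limiting weight and Y_j = g (X_1j - mu) + (1 - g) (X_2j - mu).  Up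
   to an error in the weight, sqrt N (mu_N - mu) is the normalized sum of the
   i.i.d. variables Y_j.  For a fixed index the central limit theorem is proved by
   Lindeberg's replacement method: the summands are exchanged one at a time for
   Gaussian averaging, and since Gaussian averages form a semigroup no Gaussian
   variables need to be adjoined to the probability space.  For a random index
   tau, close to some n ~ c a with high probability, Kolmogorov's maximal
   inequality bounds the fluctuation of the partial sums over a window
   [n, n + k n]; applied also to the sums of X_ij - mu and of
   (X_ij - mu)^2 - sigma_i^2, it shows that all the random weights in the window
   are close to g, because the weight function is continuous at the limit point. *)

Set Implicit Arguments.
Unset Strict Implicit.
Unset Printing Implicit Defensive.

Import Order.TTheory GRing.Theory Num.Theory.
Import numFieldNormedType.Exports.

Local Open Scope classical_set_scope.
Local Open Scope ring_scope.

(** * Independence *)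

(** No independence between the random index and the observations is available, so one cannot
    condition on the index. An estimate uniform over a window of deterministic indices takes the
    place of conditioning.

    Four kinds of sequences need the same treatment: the X_ij - mu, their centred squares, the Y_j
    and the Y_j^2 - sigma_mu^2. All are martingale differences for the joint history of both
    samples, and both Kolmogorov's inequality and the replacement argument see independence only as
    orthogonality to functions of the past. That orthogonality is therefore isolated in a record and
    proved once for functions of the pair (X_1k, X_2k).

    The test functions are described by a third-order Taylor bound and not by their derivatives:
    such a bound passes to Gaussian averages with the same constant, without differentiation under
    the integral sign.

    The weight function may jump where its two variance arguments coincide. The limit point is
    harmless because it either lies off this set or is a point where the two branches agree. *)

Section Independence.
Context {d : measure_display} {T : measurableType d} {R : realType}.
Variable P : probability T R.

Definition cylinder (I : eqType) (X : I -> T -> R) (J : set I) : set (set T) :=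
  [set B | exists s (A : I -> set R), [/\ uniq s, {in s, forall i, J i},
     forall i, measurable (A i) & B = \bigcap_(i in [set` s]) X i @^-1` A i]].

Lemma cylinder_setI_closed (I : eqType) (X : I -> T -> R) J :
  setI_closed (cylinder X J).
Proof.
move=> _ _ [s [A [us sJ mA ->]]] [s' [A' [us' sJ' mA' ->]]].
exists (undup (s ++ s')), (fun i => (if i \in s then A i else setT) `&`
                                    (if i \in s' then A' i else setT)).
split; first exact: undup_uniq.
- by move=> i; rewrite mem_undup mem_cat => /orP[/sJ|/sJ'].
- by move=> i; apply: measurableI; case: ifP.
- apply/seteqP; split=> w /=.
    move=> [h h'] i /=; rewrite mem_undup => _.
    by split; case: ifP => // ?; [exact: h|exact: h'].
  move=> h; split=> i /= si.
    by have := h i; rewrite /= mem_undup mem_cat si => /(_ isT)[].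
  by have := h i; rewrite /= mem_undup mem_cat si orbT => /(_ isT)[].
Qed.

Lemma cylinder_measurable (I : choiceType) (X : I -> {RV P >-> R}) J :
  cylinder (fun i => X i) J `<=` measurable.
Proof.
move=> _ [s [A [us sJ mA ->]]]; apply: fin_bigcap_measurable.
  exact: finite_seq.
by move=> i _; rewrite -[X in measurable X]setTI; exact: measurable_funP.
Qed.

Lemma sub_sigma_cylinder (I : choiceType) (X : I -> {RV P >-> R}) J :
  <<s cylinder (fun i => X i) J >> `<=` measurable.
Proof.
apply: smallest_sub; last exact: cylinder_measurable.
exact: sigma_algebra_measurable.
Qed.

(** As functions of [E], both sides are finite measures: the restriction of [P] to [F], and [P]
    scaled by the number [P F]. Measures that agree on a pi-system agree on the sigma-algebra it
    generates. *)
Lemma pi_lambda_independent (G : set (set T)) (F : set T) :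
  setI_closed G -> G setT -> G `<=` measurable -> measurable F ->
  (forall E, G E -> P (E `&` F) = P E * P F)%E ->
  forall E, <<s G >> E -> (P (E `&` F) = P E * P F)%E.
Proof.
move=> GI GT Gm mF GF E sE.
have PF0 : 0 <= fine (P F) by rewrite fine_ge0.
have PFE : (fine (P F))%:E = P F by rewrite fineK// fin_num_measure.
rewrite muleC -PFE.
pose m1 : {measure set T -> \bar R} := mrestr P mF.
pose m2 : {measure set T -> \bar R} := mscale (NngNum PF0) P.
apply: (g_sigma_algebra_measure_unique G Gm (fun=> setT) _ _ m1 m2) => //.
- by rewrite bigcup_const.
- by move=> A GA; rewrite /= /mrestr /mscale /= PFE muleC; exact: GF.
- move=> k; rewrite /= /mrestr setTI; exact: (le_lt_trans (probability_le1 P mF) (ltry _)).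
Qed.

(** The pi-lambda argument is applied once on each side, which leaves two cylinders. As [J] and [K]
    are disjoint, their index lists concatenate to one duplicate-free list, to which mutual
    independence applies. *)
Lemma independent_sigma_cylinder (I : choiceType) (X : I -> {RV P >-> R})
    (J K : set I) E F : mutually_independent X -> J `&` K = set0 ->
  <<s cylinder (fun i => X i) J >> E -> <<s cylinder (fun i => X i) K >> F ->
  (P (E `&` F) = P E * P F)%E.
Proof.
move=> iX JK sE sF.
have cT L : cylinder (fun i => X i) L setT.
  by exists [::], (fun=> setT); split => //; apply/seteqP; split.
apply: (pi_lambda_independent (@cylinder_setI_closed _ _ J)) sE => //.
- exact: cylinder_measurable.
- exact: sub_sigma_cylinder sF.
move=> {}E cE; rewrite setIC muleC.
apply: (pi_lambda_independent (@cylinder_setI_closed _ _ K)) sF => //.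
- exact: cylinder_measurable.
- exact: cylinder_measurable cE.
move=> {}F [s' [A' [us' sK mA' ->]]].
case: cE => s [A [us sJ mA ->]].
have dis i : i \in s -> i \in s' -> False.
  move=> /sJ Ji /sK Ki; suff : (J `&` K) i by rewrite JK.
  by split.
pose B i := if i \in s then A i else A' i.
have E1 : \bigcap_(i in [set` s]) X i @^-1` A i =
          \bigcap_(i in [set` s]) X i @^-1` B i.
  by apply: eq_bigcapr => i /= si; rewrite /B si.
have E2 : \bigcap_(i in [set` s']) X i @^-1` A' i =
          \bigcap_(i in [set` s']) X i @^-1` B i.
  apply: eq_bigcapr => i /= si; rewrite /B; case: ifPn => // /dis; by [].
have mB i : measurable (B i) by rewrite /B; case: ifP.
rewrite E1 E2 (iX s')// (iX s)//.
have -> : (\bigcap_(i in [set` s']) X i @^-1` B i) `&`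
    (\bigcap_(i in [set` s]) X i @^-1` B i) =
    \bigcap_(i in [set` s' ++ s]) X i @^-1` B i.
  apply/seteqP; split => w /=.
    by move=> [h h'] i /=; rewrite mem_cat => /orP[/h|/h'].
  by move=> h; split => i /= si; apply: h; rewrite /= mem_cat si ?orbT.
rewrite (iX (s' ++ s)) ?big_cat//.
rewrite cat_uniq us us' andbT/=; apply/hasPn => i si.
by apply/negP => /(dis _ si).
Qed.

End Independence.

(** * Integrability and expectations of real functions *)

Section Expectation.
Context {d : measure_display} {T : measurableType d} {R : realType}.
Variable P : probability T R.
Implicit Types f g : T -> R.

Definition L1 f := P.-integrable [set: T] (EFin \o f).

Lemma L1_dominated f g : measurable_fun setT f -> L1 g ->
  (forall w, `|f w| <= g w) -> L1 f.
Proof.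
move=> mf ig fg; apply: le_integrable ig => //; first exact/measurable_EFinP.
by move=> w _; rewrite /= lee_fin (le_trans (fg w))// ler_norm.
Qed.

Lemma L1_cst (r : R) : L1 (fun=> r).
Proof. exact: finite_measure_integrable_cst. Qed.

Lemma L1_bounded f (M : R) : measurable_fun setT f -> (forall w, `|f w| <= M) ->
  L1 f.
Proof. by move=> mf fM; exact: L1_dominated mf (L1_cst M) fM. Qed.

Lemma L1_indic (A : set T) : measurable A -> L1 \1_A.
Proof.
move=> mA; apply: (@L1_bounded _ 1) => [|w]; first exact: measurable_indic.
by rewrite indicE normr_nat lern1 leq_b1.
Qed.

Lemma L1D f g : L1 f -> L1 g -> L1 (fun w => f w + g w).
Proof. by move=> /integrableD h /h => /(_ measurableT). Qed.

Lemma L1B f g : L1 f -> L1 g -> L1 (fun w => f w - g w).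
Proof. by move=> /integrableB h /h => /(_ measurableT). Qed.

Lemma L1Z (r : R) f : L1 f -> L1 (fun w => r * f w).
Proof. by move=> /integrableZl => /(_ measurableT r). Qed.

Lemma L1_norm f : L1 f -> L1 (fun w => `|f w|).
Proof. by move=> /integrable_norm. Qed.

Lemma L1M f g : measurable_fun setT f -> measurable_fun setT g ->
  L1 (fun w => f w ^+ 2) -> L1 (fun w => g w ^+ 2) -> L1 (fun w => f w * g w).
Proof.
move=> mf mg if2 ig2; apply: (L1_dominated _ (L1D if2 ig2)).
  exact: measurable_funM.
move=> w; rewrite normrM -[f w ^+ 2]real_normK ?num_real//.
rewrite -[g w ^+ 2]real_normK ?num_real//.
nra.
Qed.

Lemma L1_le_exponent f k n : (k <= n)%N -> measurable_fun setT f ->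
  L1 (fun w => `|f w| ^+ n) -> L1 (fun w => `|f w| ^+ k).
Proof.
move=> kn mf ifn; apply: (L1_dominated _ (L1D (L1_cst 1) ifn)).
  by apply: measurable_funX; exact: measurableT_comp.
move=> w; rewrite ger0_norm ?exprn_ge0//.
have [f1|f1] := leP `|f w| 1.
  by rewrite (le_trans (exprn_ile1 _ (normr_ge0 _) f1))// lerDl exprn_ge0.
by rewrite (le_trans (ler_weXn2l (ltW f1) kn))// lerDr.
Qed.

Local Notation E f := (Rintegral P setT f).

Lemma E_cst (r : R) : E (fun=> r) = r.
Proof.
rewrite Rintegral_cst// -[RHS]mulr1; congr (_ * _).
by rewrite -[RHS]/(fine 1%:E) -(probability_setT P).
Qed.

Lemma E_D f g : L1 f -> L1 g -> E (fun w => f w + g w) = E f + E g.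
Proof. by move=> ? ?; rewrite RintegralD. Qed.

Lemma E_B f g : L1 f -> L1 g -> E (fun w => f w - g w) = E f - E g.
Proof. by move=> ? ?; rewrite RintegralB. Qed.

Lemma E_Z (r : R) f : L1 f -> E (fun w => r * f w) = r * E f.
Proof. by move=> ?; rewrite RintegralZl. Qed.

Lemma E_le f g : L1 f -> L1 g -> (forall w, f w <= g w) -> E f <= E g.
Proof. by move=> ? ? fg; apply: le_Rintegral. Qed.

Lemma E_norm_le f g : L1 f -> L1 g -> (forall w, `|f w| <= g w) ->
  `|E f| <= E g.
Proof.
move=> If Ig fg; apply: le_trans (E_le _ Ig fg); last exact: L1_norm.
exact: le_normr_Rintegral.
Qed.

Lemma eq_E f g : f =1 g -> E f = E g.
Proof. by move=> fg; apply: eq_Rintegral => w _. Qed.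

Lemma E_fineK f : L1 f -> (\int[P]_w (f w)%:E = (E f)%:E)%E.
Proof. by move=> If; rewrite fineK//; apply: integrable_fin_num. Qed.

Lemma E_indic (A : set T) : measurable A -> E (\1_A) = fine (P A).
Proof. by move=> mA; rewrite /Rintegral integral_indic// setIT. Qed.

Lemma markov_sqr f (l : R) : 0 < l -> measurable_fun setT f ->
  L1 (fun w => f w ^+ 2) ->
  (P [set w | (l <= `|f w|)%R] <= (E (fun w => f w ^+ 2)%R / l ^+ 2)%:E)%E.
Proof.
move=> l0 mf if2.
have mA : measurable [set w | l <= `|f w|].
  rewrite -[X in measurable X]setTI; apply: measurable_fun_le => //.
  exact: measurableT_comp.
rewrite -(fineK (fin_num_measure P _ mA)) lee_fin ler_pdivlMr ?exprn_gt0//.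
rewrite -E_indic// mulrC -E_Z; last exact: L1_indic.
apply: E_le => //; first by apply: L1Z; exact: L1_indic.
move=> w; rewrite indicE; case: (boolP (_ \in _)) => [|_]; last first.
  by rewrite mulr0 sqr_ge0.
rewrite inE /= => wA; rewrite mulr1 -[f w ^+ 2]real_normK ?num_real// ler_sqr ?nnegrE//; exact: ltW.
Qed.

End Expectation.

(** * Orthogonality derived from independence *)

Section Orthogonality.
Context {d : measure_display} {T : measurableType d} {R : realType}.
Variable P : probability T R.
Implicit Types (U V : T -> R) (G H : set (set T)).

(** The alias type carries the sigma-algebra generated by [G], so the library's closure lemmas for
    measurable functions apply to sub-sigma-algebras unchanged. *)
Definition meas_wrt G U :=
  measurable_fun [set: g_sigma_algebraType G] (U : g_sigma_algebraType G -> R).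

Lemma meas_wrt_preimage G U (A : set R) : meas_wrt G U -> measurable A ->
  <<s G >> (U @^-1` A).
Proof. by move=> mU mA; rewrite -[_ @^-1` _]setTI; exact: mU. Qed.

Lemma meas_wrt_measurable G U : <<s G >> `<=` measurable -> meas_wrt G U ->
  measurable_fun [set: T] U.
Proof.
by move=> Gm mU _ A mA; rewrite setTI; apply: Gm; exact: meas_wrt_preimage.
Qed.

Lemma meas_wrt_cylinder (I : choiceType) (X : I -> T -> R) (J : set I) i :
  J i -> meas_wrt (cylinder X J) (X i).
Proof.
move=> Ji _ A mA; rewrite setTI; apply: sub_gen_smallest.
exists [:: i], (fun=> A); split => //.
- by move=> j; rewrite inE => /eqP ->.
- apply/seteqP; split => w /= h; last by apply: h; rewrite /= inE.
  by move=> j /=; rewrite inE => /eqP ->.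
Qed.

(* The joint law of (U, V) is the product of the marginals. *)
Lemma independent_orthogonal G H U V :
  <<s G >> `<=` measurable -> <<s H >> `<=` measurable ->
  (forall A B, <<s G >> A -> <<s H >> B -> P (A `&` B) = (P A * P B)%E) ->
  meas_wrt G U -> meas_wrt H V ->
  L1 P V -> L1 P (fun w => U w * V w) -> Rintegral P setT V = 0 ->
  Rintegral P setT (fun w => U w * V w) = 0.
Proof.
move=> Gm Hm indep mU mV iV iUV EV.
have mU' := meas_wrt_measurable Gm mU.
have mV' := meas_wrt_measurable Hm mV.
have mUV : measurable_fun setT (fun w => (U w, V w)) by exact/measurable_fun_pair.
pose pU := pushforward P U.
pose u : {mfun T >-> R} := mfun_Sub (mem_set mU').
pose v : {mfun T >-> R} := mfun_Sub (mem_set mV').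
pose uv : {mfun T >-> (R * R)%type} := mfun_Sub (mem_set mUV).
pose f (z : R * R) : R := z.1 * z.2.
have mf : measurable_fun setT f by apply: measurable_funM.
have prodE A : measurable A ->
    (distribution P u \x distribution P v)%E A = distribution P uv A.
  apply: product_measure_unique => A' B mA mB.
  rewrite /distribution /pushforward /= -indep; first by [].
  - exact: meas_wrt_preimage.
  - exact: meas_wrt_preimage.
have iuv : (distribution P uv).-integrable setT (EFin \o f).
  by apply: integrable_pushforward => //; exact/measurable_EFinP.
have ifp : (distribution P u \x distribution P v)%E.-integrable setT (EFin \o f).
  move: iuv => /integrableP[mf' fin]; apply/integrableP; split=> //.
  by rewrite (eq_measure_integral (distribution P uv))// => A mA _; exact: prodE.
rewrite /Rintegral.
have -> : (\int[P]_w (U w * V w)%:E = \int[distribution P uv]_z (f z)%:E)%E.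
  by rewrite integral_pushforward//; exact/measurable_EFinP.
rewrite (eq_measure_integral (distribution P u \x distribution P v)%E);
  last by move=> A mA _; exact/esym/prodE.
(* By Fubini the second coordinate is integrated first: for each fixed [x] this leaves [x] times the
   mean of [V], which is 0. *)
rewrite -(integral12_prod_meas1 ifp) /=.
rewrite [X in fine X](_ : _ = 0%E)//; apply: integral0_eq => x _.
rewrite /fubini_F /f /=.
have iv : (distribution P v).-integrable setT (fun y => y%:E).
  by apply: integrable_pushforward => //; exact/measurable_EFinP.
under eq_integral do rewrite EFinM.
rewrite integralZl//.
have -> : (\int[distribution P v]_y y%:E = \int[P]_w (V w)%:E)%E.
  by rewrite integral_pushforward//; exact/measurable_EFinP.
by rewrite (E_fineK iV) EV mule0.
Qed.

Lemma independent_family_orthogonal (I : choiceType) (X : I -> {RV P >-> R})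
    (J K : set I) U V : mutually_independent X -> J `&` K = set0 ->
  meas_wrt (cylinder (fun i => X i) J) U ->
  meas_wrt (cylinder (fun i => X i) K) V ->
  L1 P V -> L1 P (fun w => U w * V w) -> Rintegral P setT V = 0 ->
  Rintegral P setT (fun w => U w * V w) = 0.
Proof.
move=> iX JK; apply: independent_orthogonal.
- exact: sub_sigma_cylinder.
- exact: sub_sigma_cylinder.
- by move=> A B; exact: independent_sigma_cylinder iX JK.
Qed.

End Orthogonality.

(** * Martingale differences and Kolmogorov's inequality *)

Section FrozenWalk.
Context {R : realType}.

Definition small_indic (l x : R) : R := \1_[set z : R | `|z| < l] x.

(* If the partial sums of y ever reach modulus l, this walk keeps that value
   forever, so that the maximal inequality reduces to Chebyshev's at the final time. *)
Fixpoint frozen_walk (y : nat -> R) (l : R) (k : nat) : R :=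
  match k with
  | 0 => 0
  | k'.+1 => frozen_walk y l k' + small_indic l (frozen_walk y l k') * y k'
  end.

Lemma small_indicE l x : small_indic l x = (`|x| < l)%R%:R.
Proof. by rewrite /small_indic indicE mem_setE. Qed.

Lemma measurable_small_indic l : measurable_fun setT (small_indic l).
Proof.
apply: measurable_indic; rewrite -[X in measurable X]setTI.
rewrite (_ : [set z | _] = ~` [set z | l <= `|z|]); last first.
  by apply/seteqP; split => z /=; rewrite ltNge => /negP.
rewrite setTI; apply: measurableC; rewrite -[X in measurable X]setTI.
by apply: measurable_fun_le => //; exact: measurableT_comp.
Qed.

(** A walk that has frozen keeps a modulus of at least [l]; a final modulus below [l] therefore
    certifies that it never froze and coincided with the partial sums throughout. *)
Lemma frozen_walk_lt (y : nat -> R) l n : 0 < l -> `|frozen_walk y l n| < l ->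
  frozen_walk y l n = \sum_(j < n) y j /\
  forall m, (m <= n)%N -> `|\sum_(j < m) y j| < l.
Proof.
move=> l0; elim: n => [_|n IH /=].
  rewrite big_ord0; split=> // m; rewrite leqn0 => /eqP ->.
  by rewrite big_ord0 normr0.
rewrite small_indicE; have [lt|ge] := ltP `|frozen_walk y l n| l; last first.
  by rewrite mul0r addr0 => /(le_lt_trans ge); rewrite ltxx.
have [-> h] := IH lt; rewrite mul1r.
have -> : \sum_(j < n) y j + y n = \sum_(j < n.+1) y j by rewrite big_ord_recr.
move=> h'.
split => // m; rewrite leq_eqVlt => /predU1P[->//|]; exact: h.
Qed.

End FrozenWalk.

Section MaximalInequality.
Context {d : measure_display} {T : measurableType d} {R : realType}.
Variable P : probability T R.

(** A vanishing conditional expectation given [G k] is encoded as orthogonality to every multiplier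
    measurable in the past, provided that the product is integrable. Adaptedness is stated for all j
    < k, which takes the place of monotonicity of [G]. *)
Record martingale_difference (G : nat -> set (set T)) (Y : nat -> T -> R) := {
  md_sub : forall k, <<s G k >> `<=` measurable ;
  md_adapted : forall j k, (j < k)%N -> meas_wrt (G k) (Y j) ;
  md_sqr : forall k, L1 P (fun w => Y k w ^+ 2) ;
  md_orthogonal : forall k U, meas_wrt (G k) U -> L1 P (fun w => U w * Y k w) ->
    Rintegral P setT (fun w => U w * Y k w) = 0 }.

Variables (G : nat -> set (set T)) (Y : nat -> T -> R) (v : R).
Hypothesis mdY : martingale_difference G Y.
Hypothesis Yv : forall k, Rintegral P setT (fun w => Y k w ^+ 2) <= v.

Lemma md_measurable k : measurable_fun setT (Y k).
Proof.
exact: (meas_wrt_measurable (md_sub mdY (k := k.+1)) (md_adapted mdY (ltnSn k))).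
Qed.

Lemma md_L1 k : L1 P (Y k).
Proof.
apply: (L1_dominated (md_measurable k) (L1D (L1_cst P 1) (md_sqr mdY k))) => w.
rewrite -[Y k w ^+ 2]real_normK ?num_real//; nra.
Qed.

Let M n0 l k w := frozen_walk (fun j => Y (n0 + j)%N w) l k.

Lemma frozen_walk_meas_wrt n0 l k K : (k <= K)%N ->
  meas_wrt (G (n0 + K)%N) (M n0 l k).
Proof.
elim: k => [_|k IH kK]; first exact: measurable_cst.
have mM := IH (ltnW kK).
apply: measurable_funD => //; apply: measurable_funM.
  apply: measurableT_comp mM; exact: measurable_small_indic.
by apply: (md_adapted mdY); rewrite ltn_add2l.
Qed.

Lemma frozen_walk_measurable n0 l k : measurable_fun setT (M n0 l k).
Proof.
exact: (meas_wrt_measurable (md_sub mdY (k := (n0 + k)%N))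
                            (frozen_walk_meas_wrt l (leqnn k))).
Qed.

(** Expanding the square, the cross term vanishes by orthogonality and each step adds at most [v].
    The cross term is integrable because its multiplier [M n0 l n w * I w] is bounded by [l]: the
    indicator kills it as soon as the walk is large. *)
Lemma frozen_walk_sqr n0 l n : 0 < l -> L1 P (fun w => M n0 l n w ^+ 2) /\
  Rintegral P setT (fun w => M n0 l n w ^+ 2) <= n%:R * v.
Proof.
move=> l0; elim: n => [|n [I1 I2]].
  rewrite /M /=; split; first exact: L1_cst.
  by rewrite E_cst expr0n/= mul0r.
set I := fun w => small_indic l (M n0 l n w).
have I01 w : 0 <= I w <= 1 by rewrite /I small_indicE ler0n lern1 leq_b1.
have mI : measurable_fun setT I.
  apply: measurableT_comp (frozen_walk_measurable n0 l n).
  exact: measurable_small_indic.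
have mI' : meas_wrt (G (n0 + n)%N) I.
  apply: measurableT_comp (frozen_walk_meas_wrt l (leqnn n)).
  exact: measurable_small_indic.
have MI w : `|M n0 l n w * I w| <= l.
  rewrite /I small_indicE; case: ltP => [/ltW h|_]; first by rewrite mulr1.
  by rewrite mulr0 normr0 ltW.
have E w : M n0 l n.+1 w ^+ 2 = M n0 l n w ^+ 2 +
    (2 * (M n0 l n w * I w * Y (n0 + n)%N w) + I w * Y (n0 + n)%N w ^+ 2).
  rewrite /M /= -/(M n0 l n w) -/(I w).
  have : I w * I w = I w by rewrite /I small_indicE; case: ltP; rewrite ?mulr1 ?mulr0.
  move=> /(congr1 (fun z => z * Y (n0 + n)%N w ^+ 2)) /=; lra.
have mMI : meas_wrt (G (n0 + n)%N) (fun w => M n0 l n w * I w).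
  by apply: measurable_funM => //; exact: frozen_walk_meas_wrt.
have L1a : L1 P (fun w => M n0 l n w * I w * Y (n0 + n)%N w).
  apply: (L1_dominated _ (L1Z l (L1_norm (md_L1 (n0 + n)%N)))) => [|w].
    apply: measurable_funM; last exact: md_measurable.
    by apply: measurable_funM => //; exact: frozen_walk_measurable.
  by rewrite normrM ler_wpM2r.
have L1b : L1 P (fun w => I w * Y (n0 + n)%N w ^+ 2).
  apply: (L1_dominated _ (md_sqr mdY (n0 + n)%N)) => [|w].
    by apply: measurable_funM => //; apply: measurable_funX; exact: md_measurable.
  have /andP[i0 i1] := I01 w.
  rewrite ger0_norm /=; last by rewrite mulr_ge0 ?sqr_ge0.
  by rewrite ler_piMl ?sqr_ge0.
have L1c := L1D (L1Z 2 L1a) L1b.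
split.
  have := L1D I1 L1c; congr (L1 P _); apply/funext => w; exact/esym/E.
rewrite (eq_E _ E) E_D// E_D//; last exact: L1Z.
rewrite E_Z// (md_orthogonal mdY mMI)// mulr0 add0r -natr1 mulrDl mul1r lerD//.
apply: le_trans (Yv (n0 + n)); apply: (E_le L1b (md_sqr mdY _)) => w.
have /andP[i0 i1] := I01 w; by rewrite ler_piMl ?sqr_ge0.
Qed.

Lemma kolmogorov_maximal n0 n l : 0 < l -> exists B : set T,
  [/\ measurable B, (P B <= (n%:R * v / l ^+ 2)%:E)%E &
    forall w, ~ B w -> forall m, (m <= n)%N ->
      `|\sum_(j < m) Y (n0 + j)%N w| < l].
Proof.
move=> l0; have mM := frozen_walk_measurable n0 l n.
have [I1 I2] := frozen_walk_sqr n0 n l0.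
exists [set w | l <= `|M n0 l n w|]; split.
- rewrite -[X in measurable X]setTI; apply: measurable_fun_le => //.
  exact: measurableT_comp.
- apply: (le_trans (markov_sqr l0 mM I1)); rewrite lee_fin ler_pM2r//.
  by rewrite invr_gt0 exprn_gt0.
- by move=> w /negP; rewrite -ltNge => /(frozen_walk_lt l0)[].
Qed.

End MaximalInequality.

(** * Gaussian averaging *)

Section Gaussian.
Context {R : realType}.
Local Notation leb := (@lebesgue_measure R).
Local Notation gauss := (@normal_prob R 0 1).
Local Notation Eg := (Rintegral gauss setT).

(** The Radon-Nikodym derivative of [normal_prob m s] and [normal_pdf m s] have the same integral
    over every measurable set, hence agree almost everywhere. *)
Lemma ge0_integral_normal_prob (m s : R) (f : R -> \bar R) :
  measurable_fun setT f -> (forall x, 0 <= f x)%E ->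
  (\int[normal_prob m s]_x f x = \int[leb]_x (f x * (normal_pdf m s x)%:E))%E.
Proof.
move=> mf f0; have dom := @normal_prob_dominates R m s.
rewrite -(Radon_Nikodym_SigmaFinite.change_of_variables dom)//.
apply: ae_eq_integral => //.
- apply: emeasurable_funM => //; apply: (measurable_int leb).
  exact: Radon_Nikodym_SigmaFinite.f_integrable.
- apply: emeasurable_funM => //; apply/measurable_EFinP.
  exact: measurable_normal_pdf.
- apply: ae_eqe_mul2l => /=; apply: integral_ae_eq => //.
  + exact: Radon_Nikodym_SigmaFinite.f_integrable.
  + by apply/measurable_EFinP; exact: measurable_normal_pdf.
  + by move=> A _ mA; rewrite -Radon_Nikodym_SigmaFinite.f_integral.
Qed.

Lemma normal_peakE (s : R) : 0 < s -> normal_peak s = normal_peak 1 / s.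
Proof.
move=> s0; rewrite /normal_peak expr1n mul1r -mulrnAr sqrtrM ?sqr_ge0//.
by rewrite sqrtr_sqr gtr0_norm// invfM mulrC.
Qed.

Lemma normal_pdf_gt0E (m s x : R) : 0 < s ->
  normal_pdf m s x = normal_peak 1 / s * expR (- (x - m) ^+ 2 / (2 * s ^+ 2)).
Proof.
move=> s0; rewrite normal_pdfE ?gt_eqF// normal_peakE// /normal_fun.
by rewrite mulr_natl.
Qed.

(** If [g] turns the standard density into [c] times another normal density, its expectation is [c]
    because that density has mass one. Exponential moments thus come from identities between
    densities, with no integral to compute. *)
Lemma gaussian_tilt (m s c : R) (g : R -> R) : 0 <= c ->
  measurable_fun setT g -> (forall x, 0 <= g x) ->
  (forall x, g x * normal_pdf 0 1 x = c * normal_pdf m s x) ->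
  L1 gauss g /\ Eg g = c.
Proof.
move=> c0 mg g0 gE.
have I : (\int[gauss]_x (g x)%:E = c%:E)%E.
  rewrite ge0_integral_normal_prob//; last exact/measurable_EFinP.
  under eq_integral do rewrite -EFinM gE EFinM.
  rewrite integralZl//; last exact: integrable_normal_pdf.
  by rewrite integral_normal_pdf mule1.
split; last by rewrite /Rintegral I.
apply/integrableP; split; first exact/measurable_EFinP.
under eq_integral do rewrite /= ger0_norm//.
by rewrite I ltry.
Qed.

Lemma gaussian_exp_linear (m : R) :
  L1 gauss (fun z => expR (m * z - m ^+ 2 / 2)) /\
  Eg (fun z => expR (m * z - m ^+ 2 / 2)) = 1.
Proof.
apply: (@gaussian_tilt m 1) => //.
  by apply: measurableT_comp => //; exact: measurable_funB.
move=> x; rewrite !normal_pdf_gt0E// mul1r mulrCA; congr (_ * _).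
by rewrite -expRD; congr expR; field.
Qed.

Lemma gaussian_exp_square (s : R) : 0 < s ->
  L1 gauss (fun z => expR ((1 - s ^- 2) / 2 * z ^+ 2)) /\
  Eg (fun z => expR ((1 - s ^- 2) / 2 * z ^+ 2)) = s.
Proof.
move=> s0; apply: (@gaussian_tilt 0 s) => //; first exact: ltW.
- by apply: measurableT_comp => //; exact: measurable_funM.
- move=> x; rewrite !normal_pdf_gt0E// divr1 [in RHS]mulrA [s * _]mulrC divfK ?gt_eqF//.
  rewrite mulrCA; congr (_ * _).
  by rewrite -expRD; congr expR; field; rewrite gt_eqF.
Qed.

Lemma L1_gaussian_moment4 : L1 gauss (fun z => `|z| ^+ 4).
Proof.
have s0 : 0 < Num.sqrt 2 :> R by rewrite sqrtr_gt0.
have [I _] := gaussian_exp_square s0.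
(* With s^2 = 2 the dominating function is exp(z^2/4), the square of exp(z^2/8) >= 1 + z^2/8; hence
   it is at least z^4/64. *)
apply: (L1_dominated _ (L1Z 64 I)) => [|z].
  by apply: measurable_funX.
rewrite ger0_norm ?exprn_ge0// sqr_sqrtr//.
have -> : (1 - 2^-1) / 2 * z ^+ 2 = z ^+ 2 / 8 + z ^+ 2 / 8 by field.
rewrite expRD.
have h := expR_ge1Dx (z ^+ 2 / 8).
have z0 := sqr_ge0 z.
have -> : `|z| ^+ 4 = z ^+ 2 * z ^+ 2.
  by rewrite -(real_normK (num_real z)) -exprD.
nra.
Qed.

Lemma L1_gaussian_moment k : (k <= 4)%N -> L1 gauss (fun z => `|z| ^+ k).
Proof. by move=> k4; apply: L1_le_exponent k4 _ L1_gaussian_moment4. Qed.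

Lemma L1_gaussian_id : L1 gauss id.
Proof.
apply: (L1_dominated _ (@L1_gaussian_moment 1 _)) => //.
Qed.

Lemma L1_gaussian_sqr : L1 gauss (fun z => z ^+ 2).
Proof.
apply: (L1_dominated _ (@L1_gaussian_moment 2 _)) => //.
  by move=> z; rewrite normrX.
Qed.

(* Both moments follow from [expR x >= 1 + x] applied to the exact exponential
   moments: the resulting inequality is an equality at the untilted point. *)
Lemma gaussian_mean : Eg id = 0.
Proof.
(* The unknown mean [e] is itself the tilt: the inequality becomes 1 + e^2 - e^2/2 <= 1. *)
set e := Eg id; have [I E1] := gaussian_exp_linear e.
have : Eg (fun z => 1 + (e * z - e ^+ 2 / 2)) <= 1.
  rewrite -[leRHS]E1; apply: E_le => //.
    apply: L1D; first exact: L1_cst.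
    apply: L1B; last exact: L1_cst.
    by apply: L1Z; exact: L1_gaussian_id.
  by move=> z; exact: expR_ge1Dx.
rewrite E_D; [|exact: L1_cst|]; last first.
  apply: L1B; last exact: L1_cst.
  by apply: L1Z; exact: L1_gaussian_id.
rewrite E_B; [|by apply: L1Z; exact: L1_gaussian_id|exact: L1_cst].
rewrite !E_cst E_Z; last exact: L1_gaussian_id.
rewrite -/e => h.
have : e * e <= 0 by nra.
by rewrite -expr2 real_exprn_even_le0 ?num_real// => /eqP.
Qed.

Lemma gaussian_variance : Eg (fun z => z ^+ 2) = 1.
Proof.
set v := Eg _.
have v0 : 0 <= v by apply: Rintegral_ge0 => z _; exact: sqr_ge0.
have key (s : R) : 0 < s -> (s ^+ 2 - 1) * v <= 2 * s ^+ 2 * (s - 1).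
  move=> s0; have [I E1] := gaussian_exp_square s0.
  have : Eg (fun z => 1 + (1 - s ^- 2) / 2 * z ^+ 2) <= s.
    rewrite -[leRHS]E1; apply: E_le => //.
      apply: L1D; first exact: L1_cst.
      by apply: L1Z; exact: L1_gaussian_sqr.
    by move=> z; exact: expR_ge1Dx.
  rewrite E_D; [|exact: L1_cst|by apply: L1Z; exact: L1_gaussian_sqr].
  rewrite E_cst E_Z; last exact: L1_gaussian_sqr.
  rewrite -/v => h.
  have -> : (s ^+ 2 - 1) * v = 2 * s ^+ 2 * ((1 - s ^- 2) / 2 * v).
    by field; rewrite gt_eqF.
  rewrite ler_pM2l ?mulr_gt0 ?exprn_gt0//; lra.
(* Dividing [key] by s - 1 gives (s + 1) v <= 2 s^2 for s > 1 and the reverse inequality for s < 1.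
   Moving [s] from 1 halfway towards [v] contradicts v > 1 and v < 1 respectively; in the second
   case v >= 0 keeps [s] positive. *)
apply/eqP; rewrite eq_le; apply/andP; split; rewrite leNgt; apply/negP => vlt.
  have := key (1 + (v - 1) / 2); nra.
have := key (1 - (1 - v) / 2); nra.
Qed.

End Gaussian.

(** * The semigroup of Gaussian averages *)

Section HeatSemigroup.
Context {R : realType}.
Local Notation leb := (@lebesgue_measure R).
Local Notation gauss := (@normal_prob R 0 1).

(** The heat semigroup parametrized by the standard deviation instead of time, so that composition
    adds the squares of the parameters. *)
Definition heat (s : R) (f : R -> R) (x : R) : R :=
  Rintegral gauss setT (fun z => f (x + s * z)).

Lemma measurable_affine (x s : R) : measurable_fun setT (fun z : R => x + s * z).
Proof. by apply: measurable_funD => //; exact: measurable_funM. Qed.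

Lemma heat0 f x : heat 0 f x = f x.
Proof.
rewrite /heat -[RHS](E_cst gauss); apply: eq_E => z; by rewrite mul0r addr0.
Qed.

Lemma measurable_heat (f : R -> R) s (M : R) : measurable_fun setT f ->
  (forall x, `|f x| <= M) -> measurable_fun setT (heat s f).
Proof.
move=> mf fM.
pose h (p : R * R) : \bar R := (f (p.1 + s * p.2))%:E.
have mh : measurable_fun setT h.
  apply/measurable_EFinP; apply: measurableT_comp => //.
  apply: measurable_funD; first exact: measurable_fst.
  by apply: measurable_funM => //; exact: measurable_snd.
have ih : (gauss \x gauss)%E.-integrable setT h.
  apply: (@L1_bounded _ _ _ (gauss \x gauss)%E _ M) => //.
  exact/measurable_EFinP.
have := measurable_fubini_F ih.
by move=> mF; apply: (measurableT_comp _ mF); exact: fine_measurable.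
Qed.

Lemma integral_heatE (s : R) (f : R -> R) (x : R) : 0 < s -> continuous f ->
  (forall x, 0 <= f x) ->
  (\int[gauss]_z (f (x + s * z))%:E =
   \int[leb]_y (f y * normal_pdf x s y)%:E)%E.
Proof.
move=> s0 cf f0; have mf : measurable_fun setT f.
  exact: continuous_measurable_fun.
rewrite ge0_integral_normal_prob; last 2 first.
- apply/measurable_EFinP; apply: measurableT_comp => //; exact: measurable_affine.
- by move=> z; rewrite lee_fin.
pose F (z : R) : R := x + s * z.
have dF (z : R) : is_derive z 1 F s.
  by rewrite /F; apply: is_derive_eq; rewrite /GRing.scale /= ?mulr1 ?mulr0 ?add0r ?addr0 ?mul1r.
have F'E : F^`()%classic = cst s.
  by apply/funext => z; rewrite derive1E; exact: derive_val.
rewrite [RHS](@increasing_ge0_integration_by_substitutionT _ F).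
- apply: eq_integral => z _; rewrite F'E /= -EFinM; congr EFin.
  transitivity (f (F z) * (normal_pdf x s (F z) * s)); last by rewrite mulrA.
  congr (_ * _); rewrite !normal_pdf_gt0E// divr1 [RHS]mulrAC divfK ?gt_eqF//.
  by congr (_ * expR _); rewrite /F; field; rewrite gt_eqF.
- by move=> a b ab; rewrite /F ltrD2l ltr_pM2l.
- by rewrite F'E => z; exact: cvg_cst.
- by rewrite F'E; exact: is_cvg_cst.
- by rewrite F'E; exact: is_cvg_cst.
- by move=> z; exact: ex_derive.
- rewrite /F; under eq_fun do rewrite addrC mulrC.
  apply: (@cvg_comp _ _ _ (fun z => z * s) (fun z => z + x)).
    exact/gt0_cvgMlNy/cvg_id.
  exact: cvg_addrr_Ny.
- rewrite /F; under eq_fun do rewrite addrC mulrC.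
  apply: (@cvg_comp _ _ _ (fun z => z * s) (fun z => z + x)).
    exact/gt0_cvgMly/cvg_id.
  exact: cvg_addrr.
- move=> y; apply: cvgM; first exact: cf.
  by apply: continuous_normal_pdf; rewrite gt_eqF.
- by move=> y; rewrite mulr_ge0// normal_pdf_ge0.
Qed.

(** Completing the square. For independent standard normal Z and Z', the joint density of Z and x +
    s Z + t Z' is rewritten as the density of the sum times the conditional density of Z given the
    sum. *)
Lemma normal_pdf_mul (s t x y z : R) : 0 < s -> 0 < t ->
  let r := Num.sqrt (s ^+ 2 + t ^+ 2) in
  normal_pdf 0 1 z * normal_pdf (x + s * z) t y =
  normal_pdf x r y * normal_pdf (s * (y - x) / r ^+ 2) (t / r) z.
Proof.
move=> s0 t0 r.
have st0 : 0 < s ^+ 2 + t ^+ 2 by rewrite addr_gt0 ?exprn_gt0.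
have r0 : 0 < r by rewrite sqrtr_gt0.
have r2 : r ^+ 2 = s ^+ 2 + t ^+ 2 by rewrite sqr_sqrtr// ltW.
rewrite !normal_pdf_gt0E ?divr_gt0//.
rewrite mulrACA [RHS]mulrACA -!expRD; congr (_ * expR _).
  by field; rewrite !gt_eqF.
rewrite [(t / r) ^+ 2]expr_div_n r2.
by field; rewrite !gt_eqF.
Qed.

(** Both averages are written with Lebesgue densities and the integrals exchanged; after
    [normal_pdf_mul] the inner integral is that of a conditional density, equal to one. The
    parameters 0 have no density and are treated apart. *)
Lemma heat_heat (s t : R) (f : R -> R) (x : R) : 0 <= s -> 0 <= t -> continuous f ->
  (forall x, 0 <= f x) -> (forall x, f x <= 1) ->
  heat s (heat t f) x = heat (Num.sqrt (s ^+ 2 + t ^+ 2)) f x.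
Proof.
rewrite le_eqVlt => /predU1P[<- t0 cf f0 f1|s0].
  by rewrite heat0 expr0n/= add0r sqrtr_sqr ger0_norm.
rewrite le_eqVlt => /predU1P[<- cf f0 f1|t0 cf f0 f1].
  rewrite expr0n/= addr0 sqrtr_sqr ger0_norm; last exact: ltW.
  by apply: eq_E => z; rewrite heat0.
have mf : measurable_fun setT f by exact: continuous_measurable_fun.
set r := Num.sqrt _.
have r0 : 0 < r by rewrite sqrtr_gt0 addr_gt0 ?exprn_gt0.
pose h (p : R * R) : \bar R := (f p.2 * (normal_pdf 0 1 p.1 *
   normal_pdf (x + s * p.1) t p.2))%:E.
have h0 p : (0 <= h p)%E.
  by rewrite lee_fin !mulr_ge0// normal_pdf_ge0.
have mh : measurable_fun setT h.
  apply/measurable_EFinP; apply: measurable_funM.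
    by apply: measurableT_comp => //; exact: measurable_snd.
  apply: measurable_funM.
    apply: measurableT_comp measurable_fst; exact: measurable_normal_pdf.
  under eq_fun do rewrite normal_pdf_gt0E//.
  apply: measurable_funM => //; apply: measurableT_comp => //.
  apply: measurable_funM => //; apply: measurableT_comp => //.
  apply: measurable_funX; apply: measurable_funB; first exact: measurable_snd.
  apply: measurable_funD => //; apply: measurable_funM => //.
have innerE z : ((heat t f (x + s * z))%:E =
    \int[gauss]_w (f (x + s * z + t * w))%:E)%E.
  rewrite -E_fineK//; apply: (@L1_bounded _ _ _ _ _ 1).
    apply: measurableT_comp => //; exact: measurable_affine.
  by move=> w; rewrite ger0_norm.
have heat0' z : 0 <= heat t f z by apply: Rintegral_ge0.
have outer : (\int[gauss]_z (heat t f (x + s * z))%:E =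
    \int[leb]_z \int[leb]_y h (z, y))%E.
  rewrite ge0_integral_normal_prob//; last 2 first.
  - apply/measurable_EFinP; apply: measurableT_comp; last exact: measurable_affine.
    by apply: (@measurable_heat _ _ 1) => // z; rewrite ger0_norm.
  - by move=> z; rewrite lee_fin.
  apply: eq_integral => z _; rewrite innerE integral_heatE// muleC.
  rewrite -ge0_integralZl_EFin ?normal_pdf_ge0//; last 2 first.
  - by move=> y _; rewrite lee_fin mulr_ge0// normal_pdf_ge0.
  - apply/measurable_EFinP; apply: measurable_funM => //; exact: measurable_normal_pdf.
  by apply: eq_integral => y _; rewrite -EFinM /h /= mulrCA.
rewrite /heat /Rintegral outer sfinite_Fubini// integral_heatE//.
congr fine; apply: eq_integral => y _.
under eq_integral do rewrite /h /= normal_pdf_mul// mulrA EFinM.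
rewrite integralZl//; last exact: integrable_normal_pdf.
by rewrite integral_normal_pdf mule1.
Qed.

End HeatSemigroup.

(** * The central limit theorem by Lindeberg's method *)

Section Taylor.
Context {R : realType}.
Local Notation gauss := (@normal_prob R 0 1).
Implicit Types (f a b : R -> R).

(** [a] and [b] stand for f' and f''/2, and [C] for a bound on |f'''|/6. Being pointwise and linear,
    the estimate can be integrated against any translate. *)
Definition taylor_with (C : R) f a b := forall x y,
  `|f (x + y) - f x - a x * y - b x * y ^+ 2| <= C * `|y| ^+ 3.

Definition taylor3 (C : R) f := exists a b (M : R), [/\ measurable_fun setT a,
  measurable_fun setT b, forall x, `|a x| <= M /\ `|b x| <= M & taylor_with C f a b].

(** The expansions with increments 1 and -1 determine [a x] from their half difference and [b x]
    from their half sum, up to an error [C]. *)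
Lemma taylor_bounded C f a b : (forall x, 0 <= f x <= 1) -> taylor_with C f a b ->
  forall x, `|a x| <= C + 1 /\ `|b x| <= C + 1.
Proof.
move=> f01 tf x.
have := tf x 1; have := tf x (-1).
rewrite normrN normr1 expr1n mulr1 sqrrN expr1n !mulr1.
have /andP[] := f01 x; have /andP[] := f01 (x + 1); have /andP[] := f01 (x - 1).
rewrite !ler_norml => ? ? ? ? ? ? /andP[? ?] /andP[? ?].
by split; apply/andP; split; lra.
Qed.

Lemma heat_taylor3 s f C : measurable_fun setT f -> (forall x, 0 <= f x <= 1) ->
  taylor3 C f -> taylor3 C (heat s f).
Proof.
move=> mf f01 [a [b [M [ma mb abM tf]]]].
exists (heat s a), (heat s b), M; split.
- by apply: (@measurable_heat _ a s M ma) => x; exact: (abM x).1.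
- by apply: (@measurable_heat _ b s M mb) => x; exact: (abM x).2.
- have bd (g : R -> R) : measurable_fun setT g -> (forall x, `|g x| <= M) ->
      forall x, `|heat s g x| <= M.
    move=> mg gM x; rewrite -(E_cst gauss M); apply: E_norm_le => //.
    + apply: (@L1_bounded _ _ _ _ _ M) => //.
      by apply: measurableT_comp => //; exact: measurable_affine.
    + exact: L1_cst.
  by move=> x; split; apply: bd => // z; have [] := abM z.
move=> x y.
have L1c (g : R -> R) (B : R) : measurable_fun setT g -> (forall x, `|g x| <= B) -> forall x,
    L1 gauss (fun z => g (x + s * z)).
  move=> mg gB u; apply: (@L1_bounded _ _ _ _ _ B) => //.
  by apply: measurableT_comp => //; exact: measurable_affine.
have f1 z : `|f z| <= 1 by have /andP[? ?] := f01 z; rewrite ger0_norm.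
have If := L1c f 1 mf f1; have Ia := L1c a M ma (fun x => (abM x).1) x.
have Ib := L1c b M mb (fun x => (abM x).2) x.
rewrite -(E_cst gauss (C * _)).
have -> : heat s f (x + y) - heat s f x - heat s a x * y - heat s b x * y ^+ 2 =
   Rintegral gauss setT (fun z => f (x + y + s * z) - f (x + s * z) -
      y * a (x + s * z) - y ^+ 2 * b (x + s * z)).
  rewrite E_B; [|apply: L1B; [exact: L1B|exact: L1Z]|exact: L1Z].
  rewrite E_B; [|exact: L1B|exact: L1Z].
  rewrite E_B// !E_Z//.
  by rewrite /heat -[in RHS](mulrC _ y) -[in RHS](mulrC _ (y ^+ 2)).
apply: (E_norm_le _ (L1_cst gauss (C * `|y| ^+ 3))).
  by apply: L1B; [apply: L1B; [exact: L1B|exact: L1Z]|exact: L1Z].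
move=> z; have := tf (x + s * z) y.
by rewrite (addrAC x) (mulrC (a _)) (mulrC (b _)).
Qed.

(** The expansion with increment [s * z] is averaged over [z]: mean 0 removes the first-order term
    and variance 1 turns the second-order term into [s ^+ 2 * b x]. *)
Lemma heat_step s f a b C M : 0 <= s -> measurable_fun setT f ->
  (forall x, 0 <= f x <= 1) -> (forall x, `|a x| <= M) -> taylor_with C f a b ->
  forall x, `|heat s f x - f x - s ^+ 2 * b x| <=
            s ^+ 3 * (C * Rintegral gauss setT (fun z => `|z| ^+ 3)).
Proof.
move=> s0 mf f01 aM tf x.
have f1 z : `|f z| <= 1 by have /andP[? ?] := f01 z; rewrite ger0_norm.
have If : L1 gauss (fun z => f (x + s * z)).
  apply: (@L1_bounded _ _ _ _ _ 1) => //.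
  by apply: measurableT_comp => //; exact: measurable_affine.
have I3 := @L1_gaussian_moment R 3 isT.
have -> : heat s f x - f x - s ^+ 2 * b x = Rintegral gauss setT (fun z =>
    f (x + s * z) - f x - (a x * s) * z - (s ^+ 2 * b x) * z ^+ 2).
  have Iid := L1Z (a x * s) (@L1_gaussian_id R).
  have Isq := L1Z (s ^+ 2 * b x) (@L1_gaussian_sqr R).
  have I0 := L1B If (L1_cst gauss (f x)).
  rewrite E_B//; last exact: L1B.
  rewrite E_B// E_B//; last exact: L1_cst.
  rewrite E_cst !E_Z; [|exact: L1_gaussian_sqr|exact: L1_gaussian_id].
  by rewrite gaussian_mean gaussian_variance mulr0 subr0 mulr1.
rewrite -!E_Z//; last exact: L1Z.
apply: E_norm_le; [|by do 2 apply: L1Z|].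
  apply: L1B; last by apply: L1Z; exact: L1_gaussian_sqr.
  apply: L1B; last by apply: L1Z; exact: L1_gaussian_id.
  by apply: L1B => //; exact: L1_cst.
move=> z; have := tf x (s * z).
have -> : f (x + s * z) - f x - a x * (s * z) - b x * (s * z) ^+ 2 =
  f (x + s * z) - f x - a x * s * z - s ^+ 2 * b x * z ^+ 2 by ring.
by rewrite (normrM s) (ger0_norm s0) exprMn (mulrCA C).
Qed.

End Taylor.

Section Lindeberg.
Context {d : measure_display} {T : measurableType d} {R : realType}.
Variable P : probability T R.
Local Notation gauss := (@normal_prob R 0 1).
Local Notation m3 := (Rintegral gauss setT (fun z => `|z| ^+ 3)).
Variables (G : nat -> set (set T)) (Y : nat -> T -> R) (sigma K : R).
Hypothesis sigma0 : 0 < sigma.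
Hypothesis mdY : martingale_difference P G Y.
Hypothesis mdY2 : martingale_difference P G (fun k w => Y k w ^+ 2 - sigma ^+ 2).
Hypothesis Y3 : forall k, L1 P (fun w => `|Y k w| ^+ 3).
Hypothesis YK : forall k, Rintegral P setT (fun w => `|Y k w| ^+ 3) <= K.

(** Both expectations are expanded around [W], which is a function of the past. Orthogonality of
    [Y k] removes the first-order term, and orthogonality of [Y k ^+ 2 - sigma ^+ 2] replaces the
    second-order one by its Gaussian counterpart; only the two cubic remainders are left. *)
Lemma lindeberg_step (f : R -> R) C k W h : 0 <= h -> 0 <= C ->
  measurable_fun setT f -> (forall x, 0 <= f x <= 1) -> taylor3 C f ->
  meas_wrt (G k) W ->
  `|Rintegral P setT (fun w => f (W w + h * Y k w)) -
    Rintegral P setT (fun w => heat (h * sigma) f (W w))| <=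
  C * (K + sigma ^+ 3 * m3) * h ^+ 3.
Proof.
move=> h0 C0 mf f01 [a [b [M [ma mb abM tf]]]] mW.
have mW' := meas_wrt_measurable (md_sub mdY (k := k)) mW.
have mY := md_measurable mdY k.
have f1 z : `|f z| <= 1 by have /andP[? ?] := f01 z; rewrite ger0_norm.
have bd (g : R -> R) B U : measurable_fun setT g -> (forall x, `|g x| <= B) ->
    measurable_fun setT U -> L1 P (fun w => g (U w)).
  by move=> mg gB mU; apply: (@L1_bounded _ _ _ _ _ B) => //; exact: measurableT_comp.
have IfW : L1 P (fun w => f (W w)) by apply: bd.
have mWY : measurable_fun setT (fun w => W w + h * Y k w).
  by apply: measurable_funD => //; exact: measurable_funM.
have IfWY : L1 P (fun w => f (W w + h * Y k w)) by apply: bd mWY.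
have IbW : L1 P (fun w => b (W w)) by apply: (bd _ M) => // x; have [] := abM x.
have IY := md_L1 mdY k; have IY2 := md_L1 mdY2 k.
have IaY : L1 P (fun w => a (W w) * Y k w).
  apply: (L1_dominated _ (L1Z M (L1_norm IY))) => [|w].
    by apply: measurable_funM => //; exact: measurableT_comp.
  by rewrite normrM ler_wpM2r//; have [] := abM (W w).
have IbY : L1 P (fun w => b (W w) * (Y k w ^+ 2 - sigma ^+ 2)).
  apply: (L1_dominated _ (L1Z M (L1_norm IY2))) => [|w].
    apply: measurable_funM; first exact: measurableT_comp.
    exact: (md_measurable mdY2).
  by rewrite normrM ler_wpM2r//; have [] := abM (W w).
have OaY : Rintegral P setT (fun w => a (W w) * Y k w) = 0.
  by apply: (md_orthogonal mdY) => //; exact: measurableT_comp mW.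
have ObY : Rintegral P setT (fun w => b (W w) * (Y k w ^+ 2 - sigma ^+ 2)) = 0.
  by apply: (md_orthogonal mdY2) => //; exact: measurableT_comp mW.
have IH : L1 P (fun w => heat (h * sigma) f (W w)).
  apply: (bd _ 1) => //; first exact: (measurable_heat (h * sigma) mf f1).
  move=> x; rewrite -(E_cst gauss 1); apply: E_norm_le => //; last exact: L1_cst.
  apply: (@L1_bounded _ _ _ _ _ 1) => //.
  by apply: measurableT_comp => //; exact: measurable_affine.
(* [A] and [B] are the two Taylor remainders. In [A] the quadratic term is split into a part of mean
   zero and [(h * sigma) ^+ 2 * b (W w)], the term that [B] contains as well. *)
pose A w := f (W w + h * Y k w) - f (W w) - h * (a (W w) * Y k w) -
            h ^+ 2 * (b (W w) * (Y k w ^+ 2 - sigma ^+ 2)) -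
            (h * sigma) ^+ 2 * b (W w).
pose B w := heat (h * sigma) f (W w) - f (W w) - (h * sigma) ^+ 2 * b (W w).
have IA0 := L1B IfWY IfW.
have IA1 := L1B IA0 (L1Z h IaY).
have IA2 := L1B IA1 (L1Z (h ^+ 2) IbY).
have IbW' := L1Z ((h * sigma) ^+ 2) IbW.
have IA : L1 P A by exact: L1B.
have IB0 := L1B IH IfW.
have IB : L1 P B by exact: L1B.
have EA : Rintegral P setT A = Rintegral P setT (fun w => f (W w + h * Y k w)) -
    Rintegral P setT (fun w => f (W w)) -
    (h * sigma) ^+ 2 * Rintegral P setT (fun w => b (W w)).
  rewrite /A E_B// E_B//; last exact: L1Z.
  rewrite E_B//; last exact: L1Z.
  by rewrite E_B// !E_Z// OaY ObY !mulr0 !subr0.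
have EB : Rintegral P setT B = Rintegral P setT (fun w => heat (h * sigma) f (W w)) -
    Rintegral P setT (fun w => f (W w)) -
    (h * sigma) ^+ 2 * Rintegral P setT (fun w => b (W w)).
  by rewrite /B E_B// E_B// E_Z.
have -> : Rintegral P setT (fun w => f (W w + h * Y k w)) -
    Rintegral P setT (fun w => heat (h * sigma) f (W w)) =
    Rintegral P setT A - Rintegral P setT B by rewrite EA EB; ring.
apply: (le_trans (ler_normB _ _)).
have hA : `|Rintegral P setT A| <= C * h ^+ 3 * K.
  apply: (@le_trans _ _ (Rintegral P setT (fun w => C * h ^+ 3 * `|Y k w| ^+ 3))).
    apply: E_norm_le => //; first exact: L1Z.
    move=> w; have := tf (W w) (h * Y k w).
    have -> : f (W w + h * Y k w) - f (W w) - a (W w) * (h * Y k w) -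
        b (W w) * (h * Y k w) ^+ 2 = A w by rewrite /A; ring.
    by rewrite (normrM h) (ger0_norm h0) exprMn (mulrA C).
  by rewrite E_Z// ler_wpM2l// mulr_ge0// exprn_ge0.
have hB : `|Rintegral P setT B| <= (h * sigma) ^+ 3 * (C * m3).
  rewrite -[leRHS](E_cst P); apply: E_norm_le => //; first exact: L1_cst.
  move=> w; apply: (@heat_step _ _ f a b C M) => //.
    by rewrite mulr_ge0// ltW.
  by move=> x; have [] := abM x.
apply: (le_trans (lerD hA hB)); rewrite exprMn; set q := h ^+ 3.
by rewrite le_eqVlt; apply/orP; left; apply/eqP; ring.
Qed.

End Lindeberg.

(** * Smooth approximations of the indicators of half-lines *)

Section SplineStep.
Context {R : realType}.

Definition pos_part (u : R) : R := (u + `|u|) / 2.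

Lemma pos_part_ge (u : R) : 0 <= u -> pos_part u = u.
Proof. by move=> u0; rewrite /pos_part ger0_norm//; field. Qed.

Lemma pos_part_le (u : R) : u <= 0 -> pos_part u = 0.
Proof. by move=> u0; rewrite /pos_part ler0_norm// subrr mul0r. Qed.

Lemma continuous_pos_part : continuous pos_part.
Proof.
move=> u; apply: cvgM; last exact: cvg_cst.
by apply: cvgD; [exact: cvg_id|exact: norm_continuous].
Qed.

(** The truncated cube has third derivative 0 or 6, whence the constant 6/6 = 1. The cases are the
    positions of [x] and [x + y] relative to the knot 0. *)
Lemma pos_part_cube_taylor : taylor_with 1 (fun u : R => pos_part u ^+ 3)
  (fun u => 3 * pos_part u ^+ 2) (fun u => 3 * pos_part u).
Proof.
move=> x y; rewrite mul1r -normrX.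
have [x0|x0] := leP 0 x; have [xy0|xy0] := leP 0 (x + y).
- rewrite !pos_part_ge// le_eqVlt; apply/orP; left; apply/eqP; congr `|_|; ring.
- rewrite (pos_part_le (ltW xy0)) pos_part_ge//.
  rewrite (_ : _ - _ = y ^+ 3 - (x + y) ^+ 3); last by ring.
  have y0 : y < 0 by lra.
  have y3 : y ^+ 3 <= (x + y) ^+ 3.
    rewrite -subr_ge0.
    rewrite (_ : _ - _ = x * (((2 * x + 3 * y) ^+ 2 + 3 * y ^+ 2) / 4)); last by field.
    by rewrite mulr_ge0// divr_ge0// addr_ge0 ?sqr_ge0// mulr_ge0// sqr_ge0.
  have xy3 : (x + y) ^+ 3 <= 0 by rewrite exprS mulr_le0_ge0 ?sqr_ge0 ?ltW.
  by rewrite !ler0_norm; lra.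
- rewrite (pos_part_le (ltW x0)) pos_part_ge//.
  rewrite (_ : _ - _ = (x + y) ^+ 3); last by ring.
  have y0 : 0 <= y by lra.
  by rewrite !ger0_norm ?exprn_ge0// lerXn2r ?nnegrE//; lra.
- rewrite (pos_part_le (ltW x0)) (pos_part_le (ltW xy0)).
  by rewrite !expr0n/= !(mulr0, mul0r, subr0) normr0.
Qed.

(* Distribution function of a sum of three independent uniform variables. *)
Definition spline (t : R) : R :=
  (pos_part t ^+ 3 - 3 * pos_part (t - 1) ^+ 3 +
   3 * pos_part (t - 2) ^+ 3 - pos_part (t - 3) ^+ 3) / 6.

Lemma spline_ge t : 3 <= t -> spline t = 1.
Proof. by move=> t3; rewrite /spline !pos_part_ge; try lra; field. Qed.

Lemma spline_le t : t <= 0 -> spline t = 0.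
Proof. by move=> t3; rewrite /spline !pos_part_le; try lra; rewrite expr0n/=; field. Qed.

Lemma spline01 t : 0 <= spline t <= 1.
Proof.
have [t0|t0] := leP t 0; first by rewrite spline_le// lexx ler01.
have [t3|t3] := leP 3 t; first by rewrite spline_ge// lexx ler01.
rewrite /spline (pos_part_ge (ltW t0)) (@pos_part_le (t - 3)); last lra.
have [t1|t1] := leP t 1.
  rewrite !pos_part_le; try lra.
  rewrite expr0n/=; set q := t ^+ 3.
  have : q <= 1 by rewrite exprn_ile1 // ltW.
  have : 0 <= q by rewrite exprn_ge0// ltW.
  by move=> ? ?; apply/andP; split; lra.
rewrite (@pos_part_ge (t - 1)); last lra.
have [t2|t2] := leP t 2.
  rewrite !pos_part_le; try lra.
  (* On the middle piece the cubic is written in two ways: as a sum of nonnegative terms for the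
     lower bound, and as 2 + 3u minus a nonnegative term for the upper one. *)
  set u := t - 1; have tE : t = u + 1 by rewrite /u subrK.
  have u0 : 0 <= u by lra.
  have u1 : 0 <= 1 - u by lra.
  have h1 : 0 <= u ^+ 2 * (1 - u) by rewrite mulr_ge0// sqr_ge0.
  have h2 : 0 <= (1 - u) ^+ 2 * (1 + 2 * u) by rewrite mulr_ge0 ?sqr_ge0//; lra.
  rewrite expr0n/= tE.
  rewrite (_ : _ / 6 = (1 + 3 * u + u ^+ 2 + 2 * (u ^+ 2 * (1 - u))) / 6); last by field.
  have h3 : 0 <= u ^+ 2 by exact: sqr_ge0.
  apply/andP; split; first by lra.
  rewrite (_ : _ / 6 = (2 + 3 * u - (1 - u) ^+ 2 * (1 + 2 * u)) / 6); last by field.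
  lra.
rewrite (@pos_part_ge (t - 2)); last lra.
rewrite expr0n/= (_ : _ / 6 = 1 - (3 - t) ^+ 3 / 6); last by field.
set u := 3 - t; have u0 : 0 <= u by rewrite /u; lra.
have u1 : u <= 1 by rewrite /u; lra.
set q := u ^+ 3.
have : q <= 1 by rewrite exprn_ile1.
have : 0 <= q by rewrite exprn_ge0.
by move=> ? ?; apply/andP; split; lra.
Qed.

Lemma continuous_spline : continuous spline.
Proof.
have c (r : R) : continuous (fun t => pos_part (t - r) ^+ 3).
  move=> t; apply: (@continuous_comp _ _ _ (fun t => pos_part (t - r)) (fun t => t ^+ 3)).
    apply: (@continuous_comp _ _ _ (fun t => t - r) pos_part).
      by apply: cvgB; [exact: cvg_id|exact: cvg_cst].
    exact: continuous_pos_part.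
  exact: exprn_continuous.
have c0 : continuous (fun t => pos_part t ^+ 3).
  by move=> t; have := c 0 t; under eq_fun do rewrite subr0.
move=> t; apply: cvgM; last exact: cvg_cst.
apply: cvgB; last exact: c.
apply: cvgD; last by apply: cvgM; [exact: cvg_cst|exact: c].
apply: cvgB; first exact: c0.
by apply: cvgM; [exact: cvg_cst|exact: c].
Qed.

Lemma taylor_lin (C1 C2 r1 r2 : R) (f1 a1 b1 f2 a2 b2 : R -> R) :
  taylor_with C1 f1 a1 b1 -> taylor_with C2 f2 a2 b2 ->
  taylor_with (`|r1| * C1 + `|r2| * C2) (fun x => r1 * f1 x + r2 * f2 x)
    (fun x => r1 * a1 x + r2 * a2 x) (fun x => r1 * b1 x + r2 * b2 x).
Proof.
move=> h1 h2 x y.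
rewrite (_ : _ - _ = r1 * (f1 (x + y) - f1 x - a1 x * y - b1 x * y ^+ 2) +
                     r2 * (f2 (x + y) - f2 x - a2 x * y - b2 x * y ^+ 2)); last by ring.
rewrite (le_trans (ler_normD _ _))// !normrM mulrDl -!mulrA.
by rewrite lerD// ler_wpM2l.
Qed.

Lemma taylor_affine (C al be : R) (f a b : R -> R) : taylor_with C f a b ->
  taylor_with (C * `|be| ^+ 3) (fun x => f (al + be * x))
    (fun x => be * a (al + be * x)) (fun x => be ^+ 2 * b (al + be * x)).
Proof.
move=> h x y; have := h (al + be * x) (be * y).
rewrite (_ : al + be * x + be * y = al + be * (x + y)); last by ring.
rewrite (_ : a (al + be * x) * _ = be * a (al + be * x) * y); last by ring.
rewrite (_ : b (al + be * x) * _ = be ^+ 2 * b (al + be * x) * y ^+ 2); last by ring.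
by rewrite (normrM be) exprMn (mulrA C).
Qed.

Lemma spline_taylor : exists C a b, [/\ 0 <= C, measurable_fun setT a,
  measurable_fun setT b & taylor_with C spline a b].
Proof.
have mp : measurable_fun setT pos_part.
  exact: continuous_measurable_fun continuous_pos_part.
have sh (r : R) := taylor_affine r 1 pos_part_cube_taylor.
have h := taylor_lin (1 / 6) (1 / 6)
  (taylor_lin 1 (-3) (sh 0) (sh (-1))) (taylor_lin 3 (-1) (sh (-2)) (sh (-3))).
have ms (r : R) : measurable_fun setT (fun x : R => pos_part (r + 1 * x)).
  apply: measurableT_comp => //; exact: measurable_affine.
have cM (c : R) (g : R -> R) : measurable_fun setT g ->
    measurable_fun setT (fun x => c * g x).
  by move=> mg; exact: measurable_funM.
set C := (X in taylor_with X) in h.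
set a := (X in taylor_with _ _ X) in h.
set b := (X in taylor_with _ _ _ X) in h.
exists C, a, b; split.
- by rewrite /C !normr1 !expr1n; rewrite !addr_ge0// !mulr_ge0// !addr_ge0// !mulr_ge0.
- have m2 r : measurable_fun setT (fun x : R => 1 * (3 * pos_part (r + 1 * x) ^+ 2)).
    exact: cM _ _ (cM _ _ (measurable_funX 2 (ms r))).
  exact: measurable_funD (cM _ _ (measurable_funD (cM _ _ (m2 _)) (cM _ _ (m2 _))))
                         (cM _ _ (measurable_funD (cM _ _ (m2 _)) (cM _ _ (m2 _)))).
- have m1 r : measurable_fun setT (fun x : R => 1 ^+ 2 * (3 * pos_part (r + 1 * x))).
    exact: cM _ _ (cM _ _ (ms r)).
  exact: measurable_funD (cM _ _ (measurable_funD (cM _ _ (m1 _)) (cM _ _ (m1 _))))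
                         (cM _ _ (measurable_funD (cM _ _ (m1 _)) (cM _ _ (m1 _)))).
- move: h; congr (taylor_with C _ a b); apply/funext => t; rewrite /spline.
  by rewrite !mul1r add0r [-1 + t]addrC [-2 + t]addrC [-3 + t]addrC; field.
Qed.

Lemma smooth_indicator (x e : R) : 0 < e -> exists (f : R -> R) (C : R),
  [/\ 0 <= C, continuous f, forall t, 0 <= f t <= 1, taylor3 C f &
   (forall t, t <= x -> f t = 1) /\ (forall t, x + e <= t -> f t = 0)].
Proof.
move=> e0; have [C [a [b [C0 ma mb h]]]] := spline_taylor.
(* The affine map sends [x + e] to 0 and [x] to 3, the two ends of the ramp of [spline]. *)
pose be := - (3 / e); pose al := 3 / e * (x + e).
have h' := taylor_affine al be h.
have f01 (t : R) : 0 <= spline (al + be * t) <= 1 by exact: spline01.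
exists (fun t => spline (al + be * t)), (C * `|be| ^+ 3); split => //.
- by rewrite mulr_ge0.
- move=> t; apply: (@continuous_comp _ _ _ (fun t => al + be * t) spline).
    apply: cvgD; first exact: cvg_cst.
    by apply: cvgM; [exact: cvg_cst|exact: cvg_id].
  exact: continuous_spline.
- have bd := taylor_bounded f01 h'.
  have maff := measurable_affine al be.
  eexists; eexists; exists (C * `|be| ^+ 3 + 1); split; [| |exact: bd|exact: h'].
    by apply: measurable_funM => //; exact: (measurableT_comp ma maff).
  by apply: measurable_funM => //; exact: (measurableT_comp mb maff).
- have eE t : al + be * t = 3 * ((x + e - t) / e) by rewrite /al /be; ring.
  split => t xt; rewrite eE.
    rewrite spline_ge// ler_peMr// ler_pdivlMr//; lra.
  rewrite spline_le// pmulr_rle0// pmulr_lle0 ?invr_gt0//; lra.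
Qed.

End SplineStep.

(** * The central limit theorem for martingale differences *)

Section MartingaleCLT.
Context {d : measure_display} {T : measurableType d} {R : realType}.
Variable P : probability T R.
Local Notation gauss := (@normal_prob R 0 1).
Local Notation m3 := (Rintegral gauss setT (fun z => `|z| ^+ 3)).
Variables (G : nat -> set (set T)) (Y : nat -> T -> R) (sigma K : R).
Hypothesis sigma0 : 0 < sigma.
Hypothesis mdY : martingale_difference P G Y.
Hypothesis mdY2 : martingale_difference P G (fun k w => Y k w ^+ 2 - sigma ^+ 2).
Hypothesis Y3 : forall k, L1 P (fun w => `|Y k w| ^+ 3).
Hypothesis YK : forall k, Rintegral P setT (fun w => `|Y k w| ^+ 3) <= K.

Lemma partial_sum_meas_wrt k (h : R) :
  meas_wrt (G k) (fun w => h * \sum_(j < k) Y j w).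
Proof.
apply: measurable_funM; first exact: measurable_cst.
apply: measurable_sum => j; exact: (md_adapted mdY).
Qed.

Lemma heat_bounds s (f : R -> R) : measurable_fun setT f ->
  (forall x, 0 <= f x <= 1) -> forall x, 0 <= heat s f x <= 1.
Proof.
move=> mf f01 x; have f0 z : 0 <= f z by have /andP[] := f01 z.
have f1 z : f z <= 1 by have /andP[] := f01 z.
apply/andP; split; first exact: Rintegral_ge0.
rewrite -(E_cst gauss 1); apply: E_le => //; last exact: L1_cst.
apply: (@L1_bounded _ _ _ _ _ 1); last by move=> z; rewrite ger0_norm.
by apply: measurableT_comp => //; exact: measurable_affine.
Qed.

(** The summands are removed from the last to the first, each at the price of one more Gaussian step
    of variance 1/n absorbed into the test function. A step costs a constant times n^(-3/2), and
    there are n of them. *)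
Lemma md_lindeberg (f : R -> R) C n : (0 < n)%N -> 0 <= C -> continuous f ->
  (forall x, 0 <= f x <= 1) -> taylor3 C f ->
  `|Rintegral P setT (fun w => f ((sigma * Num.sqrt n%:R)^-1 * \sum_(j < n) Y j w)) -
    Rintegral gauss setT f| <=
  C * (K / sigma ^+ 3 + m3) / Num.sqrt n%:R.
Proof.
move=> n0 C0 cf f01 tf.
have mf : measurable_fun setT f by exact: continuous_measurable_fun.
have f0 z : 0 <= f z by have /andP[] := f01 z.
have f1 z : f z <= 1 by have /andP[] := f01 z.
set r := Num.sqrt n%:R; have r0 : 0 < r by rewrite sqrtr_gt0 ltr0n.
have r2 : r ^+ 2 = n%:R by rewrite sqr_sqrtr.
set h := (sigma * r)^-1; have h0 : 0 <= h by rewrite invr_ge0 mulr_ge0// ltW.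
have hs : h * sigma = r^-1 by rewrite /h invfM mulrAC mulVf ?mul1r ?gt_eqF.
(* [H j] is the test function after [j] exchanges: [H 0] is [f], and [H n 0] is the Gaussian
   expectation of [f]. *)
pose H j := heat (Num.sqrt j%:R / r) f.
have mH j : measurable_fun setT (H j).
  by apply: (@measurable_heat _ _ _ 1) => // z; rewrite ger0_norm.
have H01 j : forall x, 0 <= H j x <= 1 by exact: heat_bounds.
have tH j : taylor3 C (H j) by exact: heat_taylor3.
have HS j x : heat (h * sigma) (H j) x = H j.+1 x.
  rewrite hs heat_heat// ?invr_ge0 ?divr_ge0 ?sqrtr_ge0 ?ltW//; congr (heat _ f x).
  have -> : r^-1 ^+ 2 + (Num.sqrt j%:R / r) ^+ 2 = j.+1%:R * r^-1 ^+ 2.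
    by rewrite exprMn sqr_sqrtr// -natr1; ring.
  by rewrite sqrtrM// sqrtr_sqr ger0_norm// invr_ge0 ltW.
set e := C * (K + sigma ^+ 3 * m3) * h ^+ 3.
have claim k j : `|Rintegral P setT (fun w => H j (h * \sum_(i < k) Y i w)) -
    H (j + k)%N 0| <= k%:R * e.
  elim: k j => [|k IH] j.
    rewrite addn0 mul0r (@eq_E _ _ _ _ _ (fun=> H j 0)); last first.
      by move=> w; rewrite big_ord0 mulr0.
    by rewrite E_cst subrr normr0.
  have := lindeberg_step sigma0 mdY mdY2 Y3 YK h0 C0 (mH j) (H01 j) (tH j)
            (@partial_sum_meas_wrt k h).
  rewrite -/e; have := IH j.+1; rewrite addSnnS.
  rewrite (eq_E P (f := fun w => H j (h * \sum_(i < k) Y i w + h * Y k w))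
    (g := fun w => H j (h * \sum_(i < k.+1) Y i w))); last first.
    by move=> w; rewrite big_ord_recr /= mulrDr.
  rewrite (eq_E P (f := fun w => heat (h * sigma) (H j) (h * \sum_(i < k) Y i w))
    (g := fun w => H j.+1 (h * \sum_(i < k) Y i w))); last by move=> w; exact: HS.
  move=> h1 h2; rewrite -natr1 mulrDl mul1r.
  rewrite -(subrKA (Rintegral P setT (fun w => H j.+1 (h * \sum_(i < k) Y i w)))).
  by rewrite (le_trans (ler_normD _ _))// addrC lerD.
have := claim n 0%N; rewrite add0n.
have -> : H n 0 = Rintegral gauss setT f.
  by apply: eq_E => z; rewrite divff ?gt_eqF// mul1r add0r.
rewrite (eq_E P (f := fun w => H 0 (h * \sum_(j < n) Y j w))
  (g := fun w => f (h * \sum_(j < n) Y j w))); last first.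
  by move=> w; rewrite /H sqrtr0 mul0r heat0.
move=> /le_trans; apply.
rewrite -r2 /e /h le_eqVlt; apply/orP; left; apply/eqP.
by field; rewrite !gt_eqF.
Qed.

Lemma md_lindeberg_eventually (f : R -> R) C (eta : R) : 0 < eta -> 0 <= C ->
  continuous f -> (forall x, 0 <= f x <= 1) -> taylor3 C f ->
  exists N, forall n, (N <= n)%N ->
  `|Rintegral P setT (fun w => f ((sigma * Num.sqrt n%:R)^-1 * \sum_(j < n) Y j w)) -
    Rintegral gauss setT f| <= eta.
Proof.
move=> eta0 C0 cf f01 tf; pose B := C * (K / sigma ^+ 3 + m3).
exists (Num.truncn ((B / eta) ^+ 2)).+1 => n nN.
have n0 : (0 < n)%N by exact: leq_trans nN.
apply: (le_trans (md_lindeberg n0 C0 cf f01 tf)); rewrite -/B.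
have r0 : 0 < Num.sqrt n%:R :> R by rewrite sqrtr_gt0 ltr0n.
rewrite ler_pdivrMr// mulrC -ler_pdivrMr//.
rewrite (le_trans (ler_norm _))// -sqrtr_sqr ler_wsqrtr//.
rewrite (le_trans (ltW (truncnS_gt _)))// ler_nat//.
Qed.

Lemma indic_leE (T' : Type) (U : T' -> R) (y : R) w :
  \1_[set w | U w <= y] w = (U w <= y)%R%:R :> R.
Proof. by rewrite indicE; congr (nat_of_bool _)%:R; apply/idP/idP; rewrite inE. Qed.

Lemma E_le_probability (d' : measure_display) (T' : measurableType d')
    (Q : probability T' R) (U : T' -> R) (f : R -> R) (y : R) :
  measurable_fun setT U -> measurable_fun setT f -> (forall t, 0 <= f t <= 1) ->
  (forall t, y <= t -> f t = 0) ->
  Rintegral Q setT (fun w => f (U w)) <= fine (Q [set w | U w <= y]).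
Proof.
move=> mU mf f01 f0.
have mA : measurable [set w | U w <= y].
  by rewrite -[X in measurable X]setTI; exact: measurable_fun_le.
rewrite -E_indic//; apply: E_le.
- apply: (@L1_bounded _ _ _ _ _ 1); first exact: measurableT_comp.
  by move=> w; have /andP[? ?] := f01 (U w); rewrite ger0_norm.
- exact: L1_indic.
- move=> w; rewrite (indic_leE U y w); have /andP[? ?] := f01 (U w).
  by have [_|/ltW /f0 ->] := leP (U w) y; rewrite ?mulr1n ?lexx.
Qed.

Lemma probability_le_E (d' : measure_display) (T' : measurableType d')
    (Q : probability T' R) (U : T' -> R) (f : R -> R) (y : R) :
  measurable_fun setT U -> measurable_fun setT f -> (forall t, 0 <= f t <= 1) ->
  (forall t, t <= y -> f t = 1) ->
  fine (Q [set w | U w <= y]) <= Rintegral Q setT (fun w => f (U w)).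
Proof.
move=> mU mf f01 f1.
have mA : measurable [set w | U w <= y].
  by rewrite -[X in measurable X]setTI; exact: measurable_fun_le.
rewrite -E_indic//; apply: E_le.
- exact: L1_indic.
- apply: (@L1_bounded _ _ _ _ _ 1); first exact: measurableT_comp.
  by move=> w; have /andP[? ?] := f01 (U w); rewrite ger0_norm.
- move=> w; rewrite (indic_leE U y w); have /andP[? ?] := f01 (U w).
  by have [/f1 ->|_] := leP (U w) y; rewrite ?mulr1n ?lexx.
Qed.

(** The indicator of t <= x lies between two smooth ramps, one descending over [x - e, x] and one
    over [x, x + e]. *)
Lemma md_clt (x e eta : R) : 0 < e -> 0 < eta -> exists N, forall n, (N <= n)%N ->
  fine (gauss [set t | t <= x - e]) - eta <=
    fine (P [set w | (sigma * Num.sqrt n%:R)^-1 * \sum_(j < n) Y j w <= x]) <=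
  fine (gauss [set t | t <= x + e]) + eta.
Proof.
move=> e0 eta0.
have [f [C [C0 cf f01 tf [fl fr]]]] := smooth_indicator x e0.
have [g [D [D0 cg g01 tg [gl gr]]]] := smooth_indicator (x - e) e0.
rewrite subrK in gr.
have mf : measurable_fun setT f by exact: continuous_measurable_fun.
have mg : measurable_fun setT g by exact: continuous_measurable_fun.
have [N1 h1] := md_lindeberg_eventually eta0 C0 cf f01 tf.
have [N2 h2] := md_lindeberg_eventually eta0 D0 cg g01 tg.
exists (maxn N1 N2) => n; rewrite geq_max => /andP[/h1 + /h2].
pose W w := (sigma * Num.sqrt n%:R)^-1 * \sum_(j < n) Y j w.
have mW : measurable_fun setT W.
  exact: meas_wrt_measurable (md_sub mdY (k := n)) (@partial_sum_meas_wrt n _).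
rewrite !ler_norml => /andP[_ hf] /andP[hg _].
have u1 := probability_le_E P mW mf f01 fl.
have u2 := E_le_probability gauss (@measurable_id _ _ setT) mf f01 fr.
have l1 := E_le_probability P mW mg g01 gr.
have l2 := probability_le_E gauss (@measurable_id _ _ setT) mg g01 gl.
by apply/andP; split; rewrite /W /= in hf hg u1 u2 l1 l2 *; lra.
Qed.

End MartingaleCLT.

(** * Random indices *)

Section RandomIndex.
Context {d : measure_display} {T : measurableType d} {R : realType}.
Variable P : probability T R.
Local Notation gauss := (@normal_prob R 0 1).

(** The event is split according to the countably many values of [tau], enumerated by [pickle]. This
    gives measurability of any statistic evaluated at a random index. *)
Lemma measurable_integer_rv (tau : T -> int) (S : int -> set T) :
  integer_rv tau -> (forall k, measurable (S k)) ->
  measurable [set w | S (tau w) w].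
Proof.
move=> mtau mS.
rewrite (_ : [set w | S (tau w) w] =
  \bigcup_k (\bigcup_(i in [set i : int | pickle i = k])
    ([set w | tau w = i] `&` S i))); last first.
  apply/seteqP; split => [w Sw|w [k _] [i _] [/= <- //]].
  by exists (pickle (tau w)) => //; exists (tau w).
apply: bigcupT_measurable => k.
have [[i ik]|h] := pselect (exists i : int, pickle i = k).
  rewrite (_ : [set i | _] = [set i]) ?bigcup_set1; first exact: measurableI.
  apply/seteqP; split => [j /= jk|j -> //].
  by apply: (pcan_inj (@pickleK int)); rewrite jk.
rewrite (_ : [set i | _] = set0) ?bigcup_set0; first exact: measurable0.
by apply/seteqP; split => // j jk; apply: h; exists j.
Qed.

(** The normal density is bounded by its peak. The estimate absorbs the small shifts of the argument
    in the limit theorem. *)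
Lemma normal_cdf_lipschitz (x y : R) : x <= y ->
  fine (gauss [set t | t <= y]) <=
  fine (gauss [set t | t <= x]) + normal_peak 1 * (y - x).
Proof.
move=> xy.
have E : [set t | t <= y] = [set t | t <= x] `|` `]x, y]%classic.
  apply/seteqP; split => t /=; rewrite in_itv/=.
    by move=> ty; have [|] := leP t x; [left|right].
  by move=> [/le_trans|/andP[]//]; apply.
have mle z : measurable [set t : R | t <= z].
  by rewrite -[X in measurable X]setTI; exact: measurable_fun_le.
have : (gauss [set t | (t <= y)%R] <=
        gauss [set t | (t <= x)%R] + (normal_peak 1 * (y - x))%:E)%E.
  rewrite E; apply: (@le_trans _ _ (gauss [set t | (t <= x)%R] + gauss `]x, y]%classic)%E).
    by apply: measureU2; [exact: mle|exact: measurable_itv].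
  apply: leeD2l; rewrite /normal_prob.
  apply: (@le_trans _ _ (\int[lebesgue_measure]_(t in `]x, y]) (normal_peak 1)%:E)%E).
    apply: ge0_le_integral => //.
    - by move=> t _; rewrite lee_fin normal_pdf_ge0.
    - by apply/measurable_EFinP/measurable_funTS; exact: measurable_normal_pdf.
    - by move=> t _; rewrite lee_fin normal_pdf_ub.
  rewrite integral_cst//= lebesgue_measure_itv/= lte_fin.
  by case: ltP => // yx; rewrite mule0 lee_fin mulr_ge0 ?normal_peak_ge0 ?subr_ge0.
have fK z : gauss [set t | t <= z] = (fine (gauss [set t | t <= z]))%:E.
  by rewrite fineK// fin_num_measure//; exact: mle.
by rewrite (fK x) (fK y) -EFinD lee_fin.
Qed.

Lemma probability_sub3 (A B C D : set T) : measurable A -> measurable B ->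
  measurable C -> measurable D -> A `<=` B `|` C `|` D ->
  fine (P A) <= fine (P B) + fine (P C) + fine (P D).
Proof.
move=> mA mB mC mD ABCD.
rewrite -lee_fin !EFinD !fineK ?fin_num_measure//.
apply: (@le_trans _ _ (P (B `|` C `|` D))).
  by apply: le_measure => //; rewrite inE//; apply: measurableU => //; exact: measurableU.
apply: (le_trans (measureU2 _ _ _)) => //; first exact: measurableU.
by apply: leeD2r; exact: measureU2.
Qed.

(** Anscombe's theorem: off two events of small probability the random index falls in a window
    starting at a deterministic [n], and there [Q] stays close to [W n], uniformly in the index. The
    joint law of [tau] and [Q] does not matter. *)
Lemma anscombe (Q W : nat -> T -> R) (c : R) (tau : R -> T -> int) (Z : R -> T -> R) :
  (forall n, measurable_fun setT (W n)) ->
  (forall delta eta : R, 0 < delta -> 0 < eta -> exists (k : R) N, 0 < k <= 1 /\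
     forall n, (N <= n)%N -> exists B, [/\ measurable B, (P B <= eta%:E)%E &
       forall w, ~ B w -> forall m, (n <= m)%N -> m%:R <= n%:R * (1 + k) ->
         `|Q m w - W n w| <= delta]) ->
  (forall x e eta : R, 0 < e -> 0 < eta -> exists N, forall n, (N <= n)%N ->
     fine (gauss [set t | t <= x - e]) - eta <= fine (P [set w | W n w <= x]) <=
     fine (gauss [set t | t <= x + e]) + eta) ->
  0 < c -> (forall a, 0 < a -> integer_rv (tau a)) ->
  cvg_in_probability P (fun a w => (tau a w)%:~R / a) c ->
  (forall a, 0 < a -> measurable_fun setT (Z a)) ->
  (forall a w, 0 < tau a w -> Z a w = Q (absz (tau a w)) w) ->
  cvg_in_distribution P Z gauss.
Proof.
move=> mW QW Wlim c0 itau cvtau mZ ZQ x _.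
have mle (U : T -> R) y : measurable_fun setT U -> measurable [set w | U w <= y].
  by move=> mU; rewrite -[X in measurable X]setTI; exact: measurable_fun_le.
have -> : [set` `]-oo, x]] = [set t | t <= x].
  by apply/seteqP; split => t /=; rewrite in_itv.
have mx : measurable [set t : R | t <= x].
  by rewrite -[X in measurable X]setTI; exact: measurable_fun_le.
rewrite -[X in _ --> X]fineK ?fin_num_measure//.
apply/fine_cvgP; split.
  exists 0; split; first exact: num_real.
  by move=> a a0; rewrite fin_num_measure//; exact/mle/mZ.
apply/cvgrPdist_le => /= eps eps0.
set p := normal_peak (1 : R); have p0 : 0 < p by exact: normal_peak_gt0.
(* Error budget: the argument is shifted by [dl] twice, which costs 2 [p * dl] = eps/4, and [eta] is
   spent three times, on the limit theorem and on the two bad events; in all 5 eps/8. *)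
pose dl := eps / (8 * p); pose eta := eps / 8.
have dl0 : 0 < dl by rewrite divr_gt0// mulr_gt0.
have eta0 : 0 < eta by rewrite divr_gt0.
have [k [N1 [/andP[k0 k1] hQ]]] := QW dl eta dl0 eta0.
have [N2 hu] := Wlim (x + dl) dl eta dl0 eta0.
have [N3 hl] := Wlim (x - dl) dl eta dl0 eta0.
(* The tolerance for tau/a is so small compared with [k] that the interval from (c - e) a to (c + e)
   a fits into [n, n (1 + k)], even after (c - e) a is rounded down to [n]. *)
pose e := k * c / 8; have e0 : 0 < e by rewrite divr_gt0// mulr_gt0.
have ec : e <= c / 8 by rewrite /e ler_pM2r ?invr_gt0// ler_piMl// ltW.
pose N := (N1 + N2 + N3 + 1)%N.
have bad := cvtau e e0.
have bad' : \forall a \near +oo, (P [set w | (e <= `|(tau a w)%:~R / a - c|)%R] <= eta%:E)%E.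
  move: bad => /fine_cvgP[fP /cvgrPdist_le /(_ eta eta0) cP].
  apply: filterS2 fP cP => a fa /=; rewrite sub0r normrN => h.
  by rewrite -(fineK fa) lee_fin; exact: le_trans (ler_norm _) h.
near=> a.
have a0 : 0 < a by near: a; exact: nbhs_pinfty_gt.
(* This bound gives n >= N, since c - e >= 7c/8; the next one lets the window length k c a outweigh
   the rounding. *)
have aN : (N%:R + 1) * 8 / (7 * c) <= a.
  by near: a; apply: nbhs_pinfty_ge; exact: num_real.
have ak : 4 / (k * c) <= a.
  by near: a; apply: nbhs_pinfty_ge; exact: num_real.
have pbad : (P [set w | (e <= `|(tau a w)%:~R / a - c|)%R] <= eta%:E)%E by near: a.
pose n := Num.truncn ((c - e) * a).
have kc0 : 0 < k * c by rewrite mulr_gt0.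
have ca0 : 0 < c * a by rewrite mulr_gt0.
have aN' : (N%:R + 1) <= 7 / 8 * (c * a).
  by move: aN; rewrite ler_pdivrMr ?mulr_gt0//; lra.
have ak' : 4 <= k * (c * a).
  by move: ak; rewrite ler_pdivrMr// mulrA (mulrC a).
have cea : 7 / 8 * (c * a) <= (c - e) * a.
  by rewrite mulrA ler_pM2r//; lra.
have cea0 : 0 <= (c - e) * a by nra.
have [n1 n2] : n%:R <= (c - e) * a /\ (c - e) * a < n%:R + 1.
  have /andP[? ?] := truncn_itv cea0.
  by rewrite natr1.
have nN : (N <= n)%N by rewrite -(ler_nat R); lra.
have kca : k * (k * (c * a)) <= k * (c * a) by rewrite ler_piMl// mulr_ge0// ltW.
have up : (c + e) * a <= n%:R * (1 + k).
  have : ((c - e) * a - 1) * (1 + k) <= n%:R * (1 + k) by rewrite ler_pM2r; lra.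
  apply: le_trans; rewrite /e.
  have -> : (c + k * c / 8) * a = c * a + k * (c * a) / 8 by ring.
  have -> : ((c - k * c / 8) * a - 1) * (1 + k) =
    c * a + 7 / 8 * (k * (c * a)) - k * (k * (c * a)) / 8 - 1 - k by field.
  lra.
have [|B [mB PB hB]] := hQ n; first by rewrite (leq_trans _ nN)// /N -!addnA leq_addr.
have nN2 : (N2 <= n)%N.
  by apply: leq_trans nN; rewrite /N -!addnA addnCA leq_addr.
have nN3 : (N3 <= n)%N.
  by apply: leq_trans nN; rewrite /N addnAC leq_addl.
have /andP[_ u] := hu n nN2; have /andP[l _] := hl n nN3.
set D := [set w | (e <= `|(tau a w)%:~R / a - c|)%R] in pbad.
have mD : measurable D.
  pose S (i : int) : set T := [set w | (e <= `|i%:~R / a - c|)%R].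
  apply: (@measurable_integer_rv (tau a) S); first exact: itau.
  move=> i; rewrite /S; have [h|h] := boolP (e <= `|i%:~R / a - c|).
    by rewrite (_ : [set _ | _] = setT)//; apply/seteqP; split.
  by rewrite (_ : [set _ | _] = set0)//; apply/seteqP; split => // w /=; exact/negP.
have close w : ~ D w -> ~ B w -> `|Z a w - W n w| <= dl.
  move=> /negP; rewrite -ltNge => Dw Bw.
  have {Dw} : `|(tau a w)%:~R - c * a| < e * a.
    rewrite -ltr_pdivrMr// -[X in _ / X](gtr0_norm a0) -normf_div.
    by rewrite mulrBl mulfK ?gt_eqF.
  rewrite ltr_norml => /andP[lo hi].
  have t0 : 0 < tau a w by rewrite -(ltr_int R); lra.
  have tE : (absz (tau a w))%:R = (tau a w)%:~R :> R.
    by rewrite -[in RHS](gtz0_abs t0).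
  rewrite ZQ//; apply: hB => //.
    by rewrite -(ler_nat R) tE; lra.
  by rewrite tE; lra.
have PBr : fine (P B) <= eta by rewrite -lee_fin fineK ?fin_num_measure.
have PDr : fine (P D) <= eta by rewrite -lee_fin fineK ?fin_num_measure.
have s1 : fine (P [set w | Z a w <= x]) <=
    fine (P [set w | W n w <= x + dl]) + fine (P B) + fine (P D).
  apply: probability_sub3 => //; [exact/mle/mZ|exact/mle|].
  move=> w Zx; have [Dw|Dw] := pselect (D w); first by right.
  have [Bw|Bw] := pselect (B w); first by left; right.
  left; left; have := close w Dw Bw; rewrite ler_norml => /andP[? ?].
  by move: Zx => /= ?; lra.
have s2 : fine (P [set w | W n w <= x - dl]) <=
    fine (P [set w | Z a w <= x]) + fine (P B) + fine (P D).
  apply: probability_sub3 => //; [exact/mle|exact/mle/mZ|].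
  move=> w Zx; have [Dw|Dw] := pselect (D w); first by right.
  have [Bw|Bw] := pselect (B w); first by left; right.
  left; left; have := close w Dw Bw; rewrite ler_norml => /andP[? ?].
  by move: Zx => /= ?; lra.
have le1 : x <= x + dl + dl by rewrite -addrA lerDl addr_ge0// ltW.
have le2 : x - dl - dl <= x by rewrite -addrA gerDl -opprD oppr_le0 addr_ge0// ltW.
have g1 := normal_cdf_lipschitz le1; have g2 := normal_cdf_lipschitz le2.
have pd : p * dl = eps / 8 by rewrite /dl; field; rewrite gt_eqF.
rewrite -/p (_ : p * _ = p * dl + p * dl) in g1; last by ring.
rewrite -/p (_ : p * _ = p * dl + p * dl) in g2; last by ring.
by rewrite ler_norml; apply/andP; split; rewrite /eta in u l PBr PDr; lra.
Unshelve. all: by end_near.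
Qed.

End RandomIndex.

(** * The two samples *)

Section Moments.
Context {d : measure_display} {T : measurableType d} {R : realType}.
Variable P : probability T R.

Lemma eq_distribution_L1 (U V : {RV P >-> R}) (g : R -> R) :
  (forall A, measurable A -> distribution P V A = distribution P U A) ->
  measurable_fun setT g -> L1 P (fun w => g (U w)) ->
  L1 P (fun w => g (V w)) /\
  Rintegral P setT (fun w => g (V w)) = Rintegral P setT (fun w => g (U w)).
Proof.
move=> VU mg Ig.
have mg' : measurable_fun setT (EFin \o g) by exact/measurable_EFinP.
have IV : L1 P (fun w => g (V w)).
  apply/integrableP; split.
    by apply/measurable_EFinP; exact: measurableT_comp.
  move/integrableP : Ig => [_].
  rewrite -(@ge0_integral_distribution _ _ _ _ _ P V (fun x => `|(g x)%:E|%E))//; last first.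
    exact: measurableT_comp.
  rewrite -(@ge0_integral_distribution _ _ _ _ _ P U (fun x => `|(g x)%:E|%E))//; last first.
    exact: measurableT_comp.
  move=> h; rewrite (eq_measure_integral (distribution P U)) => // A mA _.
  exact: VU.
split => //; congr fine.
rewrite -(@integral_distribution _ _ _ _ _ P V (fun x => (g x)%:E))//.
rewrite -(@integral_distribution _ _ _ _ _ P U (fun x => (g x)%:E))//.
by apply: eq_measure_integral => A mA _; exact: VU.
Qed.

Lemma L1_moment (U : {RV P >-> R}) n :
  ('E_P[fun w => (`|U w| ^+ n)%R] < +oo)%E -> L1 P (fun w => `|U w| ^+ n).
Proof.
rewrite unlock => h; apply/integrableP; split.
  by apply/measurable_EFinP; apply: measurable_funX; exact: measurableT_comp.
by under eq_integral do rewrite /= ger0_norm ?exprn_ge0//.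
Qed.

Lemma expectationE (U : {RV P >-> R}) m : L1 P U -> ('E_P[U] = m%:E)%E ->
  Rintegral P setT U = m.
Proof. by move=> IU; rewrite unlock => h; rewrite /Rintegral h. Qed.

Lemma varianceE_centered (U : {RV P >-> R}) m v : ('E_P[U] = m%:E)%E ->
  ('V_P[U] = v%:E)%E -> Rintegral P setT (fun w => (U w - m) ^+ 2) = v.
Proof.
move=> EU; rewrite /variance [in X in X -> _]unlock EU /= unlock => h.
by rewrite /Rintegral -[RHS]/(fine v%:E) -h; congr fine.
Qed.

(** The inequality (x + y)^2 <= 2 (x^2 + y^2), applied twice. *)
Lemma ler_normD_expr4 (x y : R) : `|x + y| ^+ 4 <= 8 * (`|x| ^+ 4 + `|y| ^+ 4).
Proof.
have -> : `|x + y| ^+ 4 = ((x + y) ^+ 2) ^+ 2.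
  by rewrite -(real_normK (num_real (x + y))) -exprM.
have -> : `|x| ^+ 4 = (x ^+ 2) ^+ 2 by rewrite -(real_normK (num_real x)) -exprM.
have -> : `|y| ^+ 4 = (y ^+ 2) ^+ 2 by rewrite -(real_normK (num_real y)) -exprM.
have h : (x + y) ^+ 2 <= 2 * (x ^+ 2 + y ^+ 2).
  rewrite -subr_ge0 (_ : _ - _ = (x - y) ^+ 2); [exact: sqr_ge0|ring].
have h2 : ((x + y) ^+ 2) ^+ 2 <= (2 * (x ^+ 2 + y ^+ 2)) ^+ 2.
  by rewrite lerXn2r ?nnegrE ?sqr_ge0// mulr_ge0// addr_ge0 ?sqr_ge0.
apply: (le_trans h2).
rewrite -subr_ge0 (_ : _ - _ = 4 * (x ^+ 2 - y ^+ 2) ^+ 2); last by ring.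
by rewrite mulr_ge0// sqr_ge0.
Qed.

End Moments.

(** * Martingale differences built from the two samples *)

Section TwoSamples.
Context {d : measure_display} {T : measurableType d} {R : realType}.
Variables (P : probability T R) (X : 'I_2 -> nat -> {RV P >-> R}).
Variables (mu : R) (sigma : 'I_2 -> R).
Hypothesis X_indep : mutually_independent (fun ij : 'I_2 * nat => X ij.1 ij.2).
Hypothesis X_id : forall i, identically_distributed (X i).
Hypothesis X_mean : forall i, ('E_P[X i 0%N] = mu%:E)%E.
Hypothesis X_var : forall i, ('V_P[X i 0%N] = (sigma i ^+ 2)%:E)%E.
Hypothesis X_moment : forall i, ('E_P[fun w => (`|X i 0%N w| ^+ 12)%R] < +oo)%E.

(** The joint history of both samples. Observations are numbered from 0, so the strict inequality
    leaves the pair with index [k] independent of it. *)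
Definition past (k : nat) : set (set T) :=
  cylinder (fun ij : 'I_2 * nat => X ij.1 ij.2 : T -> R) [set ij | (ij.2 < k)%N].

Definition centered (i : 'I_2) (j : nat) (w : T) : R := X i j w - mu.

Lemma measurable_centered i j : measurable_fun setT (centered i j).
Proof. exact: measurable_funB. Qed.

Lemma centered_id (g : R -> R) i j : measurable_fun setT g ->
  L1 P (fun w => g (centered i 0 w)) ->
  L1 P (fun w => g (centered i j w)) /\
  Rintegral P setT (fun w => g (centered i j w)) =
  Rintegral P setT (fun w => g (centered i 0 w)).
Proof.
move=> mg I0; apply: (@eq_distribution_L1 _ _ _ P (X i 0) (X i j) (fun x => g (x - mu))) => //.
- by move=> A mA; exact: X_id.
- by apply: measurableT_comp => //; exact: measurable_funB.
Qed.

Lemma L1_centered4_0 i : L1 P (fun w => `|centered i 0 w| ^+ 4).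
Proof.
have h4 : L1 P (fun w => `|X i 0 w| ^+ 4).
  by apply: L1_le_exponent (L1_moment (X_moment i)).
apply: (L1_dominated _ (L1Z 8 (L1D h4 (L1_cst P (`|mu| ^+ 4))))) => [|w].
  by apply: measurable_funX; apply: measurableT_comp => //; exact: measurable_centered.
rewrite ger0_norm ?exprn_ge0// /centered (le_trans (ler_normD_expr4 _ _))//.
by rewrite normrN.
Qed.

Lemma centered4 i j : L1 P (fun w => `|centered i j w| ^+ 4) /\
  Rintegral P setT (fun w => `|centered i j w| ^+ 4) =
  Rintegral P setT (fun w => `|centered i 0 w| ^+ 4).
Proof.
apply: (@centered_id (fun x => `|x| ^+ 4)); last exact: L1_centered4_0.
exact: measurable_funX.
Qed.

Lemma L1_centered_expr i j k : (k <= 4)%N -> L1 P (fun w => centered i j w ^+ k).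
Proof.
move=> k4.
apply: (L1_dominated _
  (L1_le_exponent k4 (measurable_centered i j) (centered4 i j).1)) => [|w].
  by apply: measurable_funX; exact: measurable_centered.
by rewrite normrX.
Qed.

Lemma L1_centered i j : L1 P (centered i j).
Proof. exact: (@L1_centered_expr i j 1). Qed.

Lemma centered_mean i j : Rintegral P setT (centered i j) = 0.
Proof.
have [_ ->] := @centered_id id i j (@measurable_id _ _ _) (L1_centered i 0).
have IX : L1 P (X i 0).
  have := L1D (L1_centered i 0) (L1_cst P mu); congr (L1 P _).
  by apply/funext => w; rewrite /centered subrK.
by rewrite /centered E_B// ?E_cst ?(expectationE IX (X_mean i)) ?subrr//; exact: L1_cst.
Qed.

Lemma centered_variance i j :
  Rintegral P setT (fun w => centered i j w ^+ 2) = sigma i ^+ 2.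
Proof.
have [|_ ->] := @centered_id (fun x => x ^+ 2) i j _ (@L1_centered_expr i 0 2 isT).
  exact: measurable_funX.
exact: (varianceE_centered (X_mean i) (X_var i)).
Qed.

Lemma centered_uncorrelated j :
  Rintegral P setT (fun w => centered 0 j w * centered 1 j w) = 0.
Proof.
apply: (independent_family_orthogonal (J := [set (0, j)]) (K := [set (1, j)]) X_indep).
- by apply/seteqP; split => // -[a b] [/= -> ].
- by apply: measurable_funB => //; exact: (meas_wrt_cylinder (i := (0, j))).
- by apply: measurable_funB => //; exact: (meas_wrt_cylinder (i := (1, j))).
- exact: L1_centered.
- by apply: L1M; [exact: measurable_centered|exact: measurable_centered|
    exact: L1_centered_expr|exact: L1_centered_expr].
- exact: centered_mean.
Qed.

(** The pair observed at time [k] uses indices disjoint from those of the past, so any centred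
    square-integrable function of it is orthogonal to the past. All martingale differences below are
    instances. *)
Lemma md_of_pair (phi : R * R -> R) : measurable_fun setT phi ->
  (forall k, L1 P (fun w => phi (centered 0 k w, centered 1 k w) ^+ 2)) ->
  (forall k, Rintegral P setT (fun w => phi (centered 0 k w, centered 1 k w)) = 0) ->
  martingale_difference P past
    (fun k w => phi (centered 0 k w, centered 1 k w)).
Proof.
move=> mphi phi2 phi0.
have mw (J : set ('I_2 * nat)) k : J (0, k) -> J (1, k) ->
    meas_wrt (cylinder (fun ij : 'I_2 * nat => X ij.1 ij.2 : T -> R) J)
      (fun w => phi (centered 0 k w, centered 1 k w)).
  move=> J0 J1; apply: measurableT_comp => //; apply: measurable_fun_pair.
    by apply: measurable_funB => //; exact: (meas_wrt_cylinder (i := (0, k))).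
  by apply: measurable_funB => //; exact: (meas_wrt_cylinder (i := (1, k))).
have mphi' k : measurable_fun setT (fun w => phi (centered 0 k w, centered 1 k w)).
  apply: measurableT_comp => //; apply: measurable_fun_pair; exact: measurable_centered.
split => //.
- by move=> k; exact: sub_sigma_cylinder.
- by move=> j k jk; exact: mw.
- move=> k U mU IU.
  apply: (independent_family_orthogonal (K := [set ij | ij.2 = k]) X_indep _ mU) => //.
  + by apply/seteqP; split => // -[a b] [/= bk bE]; move: bk; rewrite bE ltnn.
  + exact: mw.
  + apply: (L1_dominated (mphi' k) (L1D (L1_cst P 1) (phi2 k))) => w.
    rewrite -[phi _ ^+ 2]real_normK ?num_real//; nra.
Qed.

End TwoSamples.

(** * The random weights *)

Section Weights.
Context {R : realType}.
Implicit Types g : 'rV[R]_4 -> R.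

Lemma continuous_row4 g (s1 s2 x1 x2 delta : R) : continuous g -> 0 < delta ->
  exists2 rho : R, 0 < rho & forall t1 t2 y1 y2 : R,
    `|t1 - s1| < rho -> `|t2 - s2| < rho -> `|y1 - x1| < rho -> `|y2 - x2| < rho ->
    `|g (row4 t1 t2 y1 y2) - g (row4 s1 s2 x1 x2)| <= delta.
Proof.
move=> cg delta0.
have /cvgrPdist_le /(_ delta delta0) /nbhs_ballP[rho /= rho0 h] := cg (row4 s1 s2 x1 x2).
exists rho => // t1 t2 y1 y2 h1 h2 h3 h4.
rewrite distrC; apply: h; split => // i j; rewrite !mxE /ball /= distrC.
by case: j => -[|[|[|[|]]]].
Qed.

(** For distinct [s1] and [s2], perturbations below half their distance preserve their order, so the
    same branch is selected; for equal ones either branch may occur, but [tie] gives both the same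
    limit. *)
Lemma weight_close (gle ggt : 'rV[R]_4 -> R) (s1 s2 mu delta : R) :
  continuous gle -> continuous ggt ->
  (s1 = s2 -> gle (row4 s1 s2 mu mu) = ggt (row4 s1 s2 mu mu)) -> 0 < delta ->
  exists2 rho : R, 0 < rho & forall t1 t2 y1 y2 : R,
    `|t1 - s1| < rho -> `|t2 - s2| < rho -> `|y1 - mu| < rho -> `|y2 - mu| < rho ->
    `|weight gle ggt t1 t2 y1 y2 - weight gle ggt s1 s2 mu mu| <= delta.
Proof.
move=> cle cgt tie delta0.
have [r1 r10 h1] := continuous_row4 s1 s2 mu mu cle delta0.
have [r2 r20 h2] := continuous_row4 s1 s2 mu mu cgt delta0.
pose r3 := if s1 == s2 then 1 else `|s1 - s2| / 2.
have r30 : 0 < r3.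
  rewrite /r3; have [_|ne] := eqVneq s1 s2; first exact: ltr01.
  by apply: divr_gt0 => //; rewrite normr_gt0 subr_eq0.
exists (Num.min r1 (Num.min r2 r3)); first by rewrite !lt_min r10 r20 r30.
move=> t1 t2 y1 y2; rewrite !lt_min.
move=> /and3P[a1 a2 a3] /and3P[b1 b2 b3] /and3P[c1 c2 _] /and3P[d1 d2 _].
have k1 := h1 _ _ _ _ a1 b1 c1 d1; have k2 := h2 _ _ _ _ a2 b2 c2 d2.
rewrite /weight; have [s12|s12] := eqVneq s1 s2.
  have -> : (s1 <= s2) = true by rewrite s12 lexx.
  by case: ifP => _; [exact: k1|rewrite (tie s12); exact: k2].
move: a3 b3; rewrite /r3 (negbTE s12) !ltr_norml => /andP[a3 a4] /andP[b3 b4].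
case: (ltgtP s1 s2) s12 => // s12 _.
  rewrite ltr0_norm ?subr_lt0// in a3 a4 b3 b4.
  by rewrite ifT//; lra.
rewrite gtr0_norm ?subr_gt0// in a3 a4 b3 b4.
by rewrite ifF//; apply/negbTE; rewrite -ltNge; lra.
Qed.

(** Rounding down to the grid of mesh 1/(n + 1), used to make random arguments take countably many
    values. *)
Definition discretize (n : nat) (x : R) : R := (Num.floor (x * n.+1%:R))%:~R / n.+1%:R.

Lemma discretize_close n x : `|discretize n x - x| <= n.+1%:R^-1.
Proof.
rewrite /discretize; set k := Num.floor _.
have n0 : 0 < n.+1%:R :> R by rewrite ltr0n.
have /andP[k1 k2] := floor_itv (x * n.+1%:R).
rewrite -/k intrD1 in k1 k2.
have -> : k%:~R / n.+1%:R - x = (k%:~R - x * n.+1%:R) / n.+1%:R.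
  by field; rewrite gt_eqF.
rewrite normrM normfV (gtr0_norm n0) ler_piMl ?invr_ge0 ?ltW//.
by rewrite ltr_norml; apply/andP; split; lra.
Qed.

End Weights.

(** * Measurability of the estimator *)

Section MeasurableWeights.
Context {d : measure_display} {T : measurableType d} {R : realType}.

Lemma integer_rv_floor (f : T -> R) : measurable_fun setT f ->
  integer_rv (fun w => Num.floor (f w)).
Proof.
move=> mf k.
have -> : [set w | Num.floor (f w) = k] =
   [set w | k%:~R <= f w] `\` [set w | (k + 1)%:~R <= f w].
  apply/seteqP; split => w /=.
    by move=> <-; split; [exact: floor_le|apply/negP; rewrite -ltNge floorD1_gt].
  by move=> [h1 /negP]; rewrite -ltNge => h2; apply: floor_def; rewrite h1.
have m (r : R) : measurable [set w | r <= f w].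
  by rewrite -[X in measurable X]setTI; apply: measurable_fun_le.
exact: measurableD.
Qed.

(** By continuity the function is the pointwise limit of its values at discretized arguments. For
    these, fixing the four integer values one after the other reduces measurability to a constant
    condition. *)
Lemma measurable_row4 (g : 'rV[R]_4 -> R) (f1 f2 f3 f4 : T -> R) : continuous g ->
  measurable_fun setT f1 -> measurable_fun setT f2 ->
  measurable_fun setT f3 -> measurable_fun setT f4 ->
  measurable_fun setT (fun w => g (row4 (f1 w) (f2 w) (f3 w) (f4 w))).
Proof.
move=> cg m1 m2 m3 m4.
apply: (@measurable_fun_cvg _ _ _ _ (fun n w => g (row4 (discretize n (f1 w))
  (discretize n (f2 w)) (discretize n (f3 w)) (discretize n (f4 w))))).
  move=> n _ A mA; rewrite setTI /discretize.
  have mf (f : T -> R) : measurable_fun setT f ->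
      integer_rv (fun w => Num.floor (f w * n.+1%:R)).
    by move=> mf; apply: integer_rv_floor; exact: measurable_funM.
  pose D (i : int) : R := i%:~R / n.+1%:R.
  apply: (@measurable_integer_rv _ _ _ (fun i => [set w | A (g (row4 (D i) (D _) (D _) (D _)))])
    (mf _ m1)) => i1.
  apply: (@measurable_integer_rv _ _ _ (fun i => [set w | A (g (row4 (D i1) (D i) (D _) (D _)))])
    (mf _ m2)) => i2.
  apply: (@measurable_integer_rv _ _ _ (fun i => [set w | A (g (row4 (D i1) (D i2) (D i) (D _)))])
    (mf _ m3)) => i3.
  apply: (@measurable_integer_rv _ _ _ (fun i => [set w | A (g (row4 (D i1) (D i2) (D i3) (D i)))])
    (mf _ m4)) => i4.
  have [h|h] := pselect (A (g (row4 (D i1) (D i2) (D i3) (D i4)))).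
    by rewrite (_ : [set _ | _] = setT)//; apply/seteqP; split.
  by rewrite (_ : [set _ | _] = set0)//; apply/seteqP; split.
move=> w _; apply/cvgrPdist_le => /= eps eps0.
have [rho rho0 h] := continuous_row4 (f1 w) (f2 w) (f3 w) (f4 w) cg eps0.
near=> n.
have nrho : n.+1%:R^-1 < rho.
  by near: n; exact: near_infty_natSinv_lt (PosNum rho0).
by rewrite distrC; apply: h; apply: le_lt_trans (discretize_close _ _) nrho.
Unshelve. all: by end_near.
Qed.

Lemma measurable_weight (gle ggt : 'rV[R]_4 -> R) (f1 f2 f3 f4 : T -> R) :
  continuous gle -> continuous ggt ->
  measurable_fun setT f1 -> measurable_fun setT f2 ->
  measurable_fun setT f3 -> measurable_fun setT f4 ->
  measurable_fun setT (fun w => weight gle ggt (f1 w) (f2 w) (f3 w) (f4 w)).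
Proof.
move=> cle cgt m1 m2 m3 m4; rewrite /weight.
apply: measurable_fun_ifT; [exact: measurable_fun_ler|exact: measurable_row4|
  exact: measurable_row4].
Qed.

Lemma measurable_sample_mean (Xs : nat -> T -> R) N :
  (forall j, measurable_fun setT (Xs j)) -> measurable_fun setT (sample_mean Xs N).
Proof. by move=> mX; apply: measurable_funM => //; exact: measurable_sum. Qed.

Lemma measurable_sample_variance (Xs : nat -> T -> R) N :
  (forall j, measurable_fun setT (Xs j)) -> measurable_fun setT (sample_variance Xs N).
Proof.
move=> mX; apply: measurable_funM => //; apply: measurable_sum => j.
by apply: measurable_funX; apply: measurable_funB => //; exact: measurable_sample_mean.
Qed.

Lemma measurable_common_mean (gle ggt : 'rV[R]_4 -> R) (X1 X2 : nat -> T -> R) N :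
  continuous gle -> continuous ggt ->
  (forall j, measurable_fun setT (X1 j)) -> (forall j, measurable_fun setT (X2 j)) ->
  measurable_fun setT (common_mean gle ggt X1 X2 N).
Proof.
move=> cle cgt m1 m2.
have mw : measurable_fun setT (fun w => weight gle ggt (sample_variance X1 N w)
    (sample_variance X2 N w) (sample_mean X1 N w) (sample_mean X2 N w)).
  by apply: measurable_weight => //; (exact: measurable_sample_variance ||
    exact: measurable_sample_mean).
apply: measurable_funD; apply: measurable_funM => //.
- exact: measurable_sample_mean.
- exact: measurable_funB.
- exact: measurable_sample_mean.
Qed.

End MeasurableWeights.

(** * Deterministic estimates on a window *)

Section Deterministic.
Context {R : realType}.

Lemma sample_mean_centered (T : Type) (Xs : nat -> T -> R) (mu : R) m w : (0 < m)%N ->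
  sample_mean Xs m w = mu + (\sum_(j < m) (Xs j w - mu)) / m%:R.
Proof.
move=> m0; rewrite /sample_mean sumrB sumr_const card_ord -mulr_natl.
by field; rewrite pnatr_eq0 -lt0n.
Qed.

(** The isolated [v] in the numerator comes from the divisor m - 1: the sum removes [v] m times, one
    time too many. *)
Lemma sample_variance_centered (T : Type) (Xs : nat -> T -> R) (mu v : R) m w :
  (1 < m)%N ->
  let A := \sum_(j < m) (Xs j w - mu) in
  sample_variance Xs m w - v =
  (\sum_(j < m) ((Xs j w - mu) ^+ 2 - v) + v - A ^+ 2 / m%:R) / (m%:R - 1).
Proof.
move=> m1 A; have m0 : (0 < m)%N by exact: ltnW.
rewrite /sample_variance (sample_mean_centered _ mu)// -/A.
have mE : m.-1%:R = m%:R - 1 :> R by rewrite -subn1 natrB.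
have mn : m%:R - 1 != 0 :> R by rewrite -mE pnatr_eq0 -lt0n -subn1 subn_gt0.
have mp : m%:R != 0 :> R by rewrite pnatr_eq0 -lt0n.
have -> : \sum_(j < m) (Xs j w - (mu + A / m%:R)) ^+ 2 =
    \sum_(j < m) (Xs j w - mu) ^+ 2 - A ^+ 2 / m%:R.
  rewrite (eq_bigr (fun j : 'I_m => (Xs j w - mu) ^+ 2 -
     (2 * A / m%:R * (Xs j w - mu) - (A / m%:R) ^+ 2))); last by move=> j _; ring.
  rewrite sumrB sumrB -mulr_sumr sumr_const card_ord -mulr_natl -/A.
  by field.
rewrite sumrB sumr_const card_ord -mulr_natl mE.
by field; rewrite mp mn.
Qed.

Lemma sample_mean_close (T : Type) (Xs : nat -> T -> R) (mu L rho q : R) n m w :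
  0 <= L -> 0 < q -> q ^+ 2 = n%:R -> (n <= m)%N ->
  `|\sum_(j < m) (Xs j w - mu)| <= L * q -> L < rho * q ->
  `|sample_mean Xs m w - mu| < rho.
Proof.
move=> L0 q0 qn nm hA Lq.
have n0 : (0 < n)%N by rewrite -(ltr0n R) -qn exprn_gt0.
have m0 : (0 < m)%N := leq_trans n0 nm.
rewrite (sample_mean_centered _ mu)// addrC addKr normrM normfV.
have mp : 0 < m%:R :> R by rewrite ltr0n.
rewrite (gtr0_norm mp) ltr_pdivrMr//.
have : q ^+ 2 <= m%:R by rewrite qn ler_nat.
have rq : 0 < rho * q by exact: le_lt_trans Lq.
have r0 : 0 < rho by rewrite -(pmulr_lgt0 _ q0).
move=> qm; apply: (le_lt_trans hA).
apply: (@lt_le_trans _ _ (rho * q ^+ 2)); last by rewrite ler_pM2l.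
by rewrite expr2 mulrA ltr_pM2r.
Qed.

(** With q = sqrt n, the numerator of the centred formula is at most L q + v + L^2, since A^2/m <=
    L^2, while [2 <= q] gives a denominator m - 1 >= q^2/2. The quotient is thus of order 1/q. *)
Lemma sample_variance_close (T : Type) (Xs : nat -> T -> R) (mu v L rho q : R) n m w :
  0 <= L -> 0 <= v -> 2 <= q -> q ^+ 2 = n%:R -> (n <= m)%N ->
  `|\sum_(j < m) (Xs j w - mu)| <= L * q ->
  `|\sum_(j < m) ((Xs j w - mu) ^+ 2 - v)| <= L * q ->
  2 * (L + v + L ^+ 2) < rho * q ->
  `|sample_variance Xs m w - v| < rho.
Proof.
move=> L0 v0 q2 qn nm hA hC Lq.
have q0 : 0 < q by lra.
have n1 : (1 < n)%N by rewrite -(ltr_nat R) -qn; nra.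
have m1 : (1 < m)%N := leq_trans n1 nm.
rewrite (@sample_variance_centered _ Xs mu v m w m1); set A := \sum_(j < m) _ in hA *.
set C := \sum_(j < m) _ in hC *.
have qm : q ^+ 2 <= m%:R by rewrite qn ler_nat.
have q4 : 4 <= q ^+ 2 by nra.
have mp : 0 < m%:R :> R by lra.
have mp1 : 0 < m%:R - 1 :> R by lra.
rewrite normrM normfV (gtr0_norm mp1) ltr_pdivrMr//.
have hA2 : A ^+ 2 / m%:R <= L ^+ 2.
  rewrite ler_pdivrMr//; apply: (@le_trans _ _ ((L * q) ^+ 2)).
    by rewrite -(real_normK (num_real A)) lerXn2r ?nnegrE// mulr_ge0// ltW.
  by rewrite exprMn ler_wpM2l// sqr_ge0.
have hA0 : 0 <= A ^+ 2 / m%:R by rewrite divr_ge0 ?sqr_ge0// ltW.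
have S1 : `|C + v - A ^+ 2 / m%:R| <= L * q + v + L ^+ 2.
  move: hC; rewrite !ler_norml => /andP[c1 c2]; apply/andP; split; lra.
have rq : 0 < rho * q by have := sqr_ge0 L; lra.
have r0 : 0 < rho by rewrite -(pmulr_lgt0 _ q0).
apply: (le_lt_trans S1).
apply: (@lt_le_trans _ _ (rho * (q ^+ 2 / 2))); last by rewrite ler_pM2l//; lra.
have h1 : 2 * (L + v + L ^+ 2) * q < rho * q * q by rewrite ltr_pM2r.
have h2 : 0 <= (v + L ^+ 2) * (q - 1).
  by rewrite mulr_ge0//; [rewrite addr_ge0// sqr_ge0|lra].
have -> : rho * (q ^+ 2 / 2) = rho * q * q / 2 by field.
lra.
Qed.

(* The scaled estimator differs from the scaled sum of [g A + (1 - g) B] at time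
   n by the increment of that sum, by the error in the weight, and by the change
   of normalization. *)
Lemma estimator_close (sg g h A B An Bn q r L L' k d1 d2 : R) :
  0 < sg -> 0 < q -> q <= r -> r ^+ 2 <= q ^+ 2 * (1 + k) -> 0 <= k -> 0 <= L ->
  `|A| <= L * q -> `|B| <= L * q ->
  `|g * An + (1 - g) * Bn| <= L' * q ->
  `|g * A + (1 - g) * B - (g * An + (1 - g) * Bn)| <= d1 * q ->
  `|h - g| <= d2 ->
  `|r * (h * (A / r ^+ 2) + (1 - h) * (B / r ^+ 2)) / sg -
    (sg * q)^-1 * (g * An + (1 - g) * Bn)| <= (d1 + 2 * L * d2 + L' * k) / sg.
Proof.
move=> sg0 q0 qr rk k0 L0 hA hB; set S := g * An + _; set S' := g * A + _.
move=> hS hS' hg.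
have r0 : 0 < r by lra.
have -> : r * (h * (A / r ^+ 2) + (1 - h) * (B / r ^+ 2)) / sg - (sg * q)^-1 * S =
   ((S' - S) / r + (h - g) * (A - B) / r - S / q * (1 - q / r)) / sg.
  by rewrite /S'; field; rewrite !gt_eqF.
rewrite normrM normfV (gtr0_norm sg0) ler_pM2r ?invr_gt0//.
apply: (le_trans (ler_normB _ _)); apply: lerD; last first.
  rewrite normrM; apply: ler_pM => //.
    by rewrite normrM normfV (gtr0_norm q0) ler_pdivrMr.
  have h1 : r <= q * (1 + k).
    rewrite -(ler_pXn2r (n := 2)) ?nnegrE//; [|exact: ltW|by rewrite mulr_ge0 ?addr_ge0// ltW].
    apply: (le_trans rk); rewrite exprMn ler_pM2l ?exprn_gt0//.
    by rewrite expr2 ler_peMl; lra.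
  have h2 : q / r <= 1 by rewrite ler_pdivrMr// mul1r.
  rewrite ger0_norm ?subr_ge0// -(ler_pM2r r0) mulrBl mul1r divfK ?gt_eqF//.
  have : k * q <= k * r by rewrite ler_wpM2l.
  lra.
apply: (le_trans (ler_normD _ _)); apply: lerD.
  rewrite normrM normfV (gtr0_norm r0) ler_pdivrMr//; apply: (le_trans hS').
  have d10 : 0 <= d1 by rewrite -(pmulr_lge0 _ q0); exact: le_trans hS'.
  by rewrite ler_wpM2l.
rewrite normrM normfV (gtr0_norm r0) ler_pdivrMr// normrM.
have hAB : `|A - B| <= 2 * L * r.
  apply: (le_trans (ler_normB _ _)).
  have : L * q <= L * r by rewrite ler_wpM2l.
  lra.
have : `|h - g| * `|A - B| <= d2 * (2 * L * r) by exact: ler_pM.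
lra.
Qed.

End Deterministic.

Lemma ord2P (Q : 'I_2 -> Prop) : Q 0 -> Q 1 -> forall i, Q i.
Proof.
move=> Q0 Q1 [[|[|//]] lti].
- by rewrite (_ : Ordinal _ = 0)//; exact: val_inj.
- by rewrite (_ : Ordinal _ = 1)//; exact: val_inj.
Qed.

(** * Moments and martingale structure of the limiting summands *)

Section CommonMeanCLT.
Context {d : measure_display} {T : measurableType d} {R : realType}.
Variables (P : probability T R) (X : 'I_2 -> nat -> {RV P >-> R}).
Variables (mu : R) (sigma : 'I_2 -> R).
Hypothesis X_indep : mutually_independent (fun ij : 'I_2 * nat => X ij.1 ij.2).
Hypothesis X_id : forall i, identically_distributed (X i).
Hypothesis X_mean : forall i, ('E_P[X i 0%N] = mu%:E)%E.
Hypothesis X_var : forall i, ('V_P[X i 0%N] = (sigma i ^+ 2)%:E)%E.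
Hypothesis X_moment : forall i, ('E_P[fun w => (`|X i 0%N w| ^+ 12)%R] < +oo)%E.

Local Notation E f := (Rintegral P setT f).
Local Notation cX := (centered X mu).
Local Notation md := (martingale_difference P (past X)).


Let cexpr i j k (k4 : (k <= 4)%N) := L1_centered_expr mu X_id X_moment i j k4.
Let cL1 i j := L1_centered mu X_id X_moment i j.
Let cmean i j := centered_mean X_id X_mean X_moment i j.
Let cvar i j := centered_variance X_id X_mean X_var X_moment i j.
Let cunc j := centered_uncorrelated X_indep X_id X_mean X_moment j.
Let mc i j := measurable_centered X mu i j.

Lemma md_of_single i (f : R -> R) : measurable_fun setT f ->
  (forall k, L1 P (fun w => f (cX i k w) ^+ 2)) ->
  (forall k, E (fun w => f (cX i k w)) = 0) -> md (fun k w => f (cX i k w)).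
Proof.
elim/ord2P: i => mf f2 f0.
- apply: (md_of_pair X_indep (phi := fun p => f p.1)) => //.
  by apply: measurableT_comp => //; exact: measurable_fst.
- apply: (md_of_pair X_indep (phi := fun p => f p.2)) => //.
  by apply: measurableT_comp => //; exact: measurable_snd.
Qed.

Lemma md_centered i : md (cX i).
Proof. by apply: (@md_of_single i id) => // k; exact: cexpr. Qed.

Definition square_dev (i : 'I_2) (j : nat) (w : T) : R := cX i j w ^+ 2 - sigma i ^+ 2.

Lemma L1_square_dev i j : L1 P (fun w => square_dev i j w ^+ 2).
Proof.
have h4 := @cexpr i j 4 isT; have h2 := @cexpr i j 2 isT.
have := L1D (L1B h4 (L1Z (2 * sigma i ^+ 2) h2)) (L1_cst P (sigma i ^+ 4)).
by congr (L1 P _); apply/funext => w; rewrite /square_dev; ring.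
Qed.

Lemma md_square_dev i : md (square_dev i).
Proof.
apply: (@md_of_single i (fun x => x ^+ 2 - sigma i ^+ 2)).
- by apply: measurable_funB => //; exact: measurable_funX.
- by move=> k; exact: L1_square_dev.
- move=> k; rewrite E_B; [|exact: cexpr|exact: L1_cst].
  by rewrite cvar E_cst subrr.
Qed.

Lemma square_dev_variance i j :
  E (fun w => square_dev i j w ^+ 2) = E (fun w => square_dev i 0 w ^+ 2).
Proof.
apply: (centered_id X_id (g := fun x => (x ^+ 2 - sigma i ^+ 2) ^+ 2) j _
  (L1_square_dev i 0)).2.
by apply: measurable_funX; apply: measurable_funB => //; exact: measurable_funX.
Qed.

Section Mixture.
Variables (g v : R).
Hypothesis vE : v = g ^+ 2 * sigma 0 ^+ 2 + (1 - g) ^+ 2 * sigma 1 ^+ 2.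

Definition mixture (j : nat) (w : T) : R := g * cX 0 j w + (1 - g) * cX 1 j w.

Lemma measurable_mixture j : measurable_fun setT (mixture j).
Proof. by apply: measurable_funD; apply: measurable_funM. Qed.

Lemma L1_mixture4 j : L1 P (fun w => `|mixture j w| ^+ 4).
Proof.
have h i := (centered4 mu X_id X_moment i j).1.
apply: (L1_dominated _ (L1Z 8 (L1D (L1Z (`|g| ^+ 4) (h 0)) (L1Z (`|1 - g| ^+ 4) (h 1))))) => [|w].
  by apply: measurable_funX; apply: measurableT_comp => //; exact: measurable_mixture.
rewrite ger0_norm ?exprn_ge0// (le_trans (ler_normD_expr4 _ _))//.
by rewrite !normrM !exprMn.
Qed.

(** An upper bound for the fourth absolute moments, uniform in the index; the 8 is that of
    [ler_normD_expr4]. *)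
Definition mixture_moment4 : R := 8 *
  (`|g| ^+ 4 * E (fun w => `|cX 0 0 w| ^+ 4) + `|1 - g| ^+ 4 * E (fun w => `|cX 1 0 w| ^+ 4)).

Lemma mixture4_le j : E (fun w => `|mixture j w| ^+ 4) <= mixture_moment4.
Proof.
have h i := centered4 mu X_id X_moment i j.
rewrite /mixture_moment4 -(h 0).2 -(h 1).2.
have I0 := L1Z (`|g| ^+ 4) (h 0).1; have I1 := L1Z (`|1 - g| ^+ 4) (h 1).1.
rewrite -(E_Z (`|g| ^+ 4) (h 0).1) -(E_Z (`|1 - g| ^+ 4) (h 1).1) -E_D// -E_Z; last exact: L1D.
apply: E_le; [exact: L1_mixture4|by apply: L1Z; exact: L1D|].
move=> w; rewrite (le_trans (ler_normD_expr4 _ _))//.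
by rewrite !normrM !exprMn.
Qed.

Lemma L1_mixture_expr j k : (k <= 4)%N -> L1 P (fun w => `|mixture j w| ^+ k).
Proof.
move=> k4; apply: L1_le_exponent k4 _ (L1_mixture4 j); exact: measurable_mixture.
Qed.

Lemma mixture_moment3 j : E (fun w => `|mixture j w| ^+ 3) <= 1 + mixture_moment4.
Proof.
apply: (@le_trans _ _ (E (fun w => 1 + `|mixture j w| ^+ 4))).
  apply: E_le; [exact: L1_mixture_expr|by apply: L1D; [exact: L1_cst|exact: L1_mixture4]|].
  move=> w; set x := `|_|; have x0 : 0 <= x by exact: normr_ge0.
  have [x1|x1] := leP x 1.
    by rewrite (le_trans (exprn_ile1 _ x0 x1))// lerDl exprn_ge0.
  by rewrite (le_trans (ler_weXn2l (ltW x1) (isT : (3 <= 4)%N)))// lerDr.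
rewrite E_D; [|exact: L1_cst|exact: L1_mixture4].
by rewrite E_cst lerD2l mixture4_le.
Qed.

Lemma L1_mixture_sqr j : L1 P (fun w => mixture j w ^+ 2).
Proof.
have := @L1_mixture_expr j 2 isT; congr (L1 P _).
by apply/funext => w; rewrite real_normK// num_real.
Qed.

Lemma mixture_variance j : E (fun w => mixture j w ^+ 2) = v.
Proof.
have I01 : L1 P (fun w => cX 0 j w * cX 1 j w).
  by apply: L1M; [exact: mc|exact: mc|exact: cexpr|exact: cexpr].
have I0 := @cexpr 0 j 2 isT; have I1 := @cexpr 1 j 2 isT.
have J0 := L1Z (g ^+ 2) I0; have J1 := L1Z ((1 - g) ^+ 2) I1.
have J2 := L1Z (2 * g * (1 - g)) I01.
rewrite (eq_E P (g := fun w => g ^+ 2 * cX 0 j w ^+ 2 + (1 - g) ^+ 2 * cX 1 j w ^+ 2 +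
   2 * g * (1 - g) * (cX 0 j w * cX 1 j w))); last first.
  by move=> w; rewrite /mixture; ring.
by rewrite E_D//; [rewrite E_D// !E_Z// !cvar cunc mulr0 addr0 vE|exact: L1D].
Qed.

Lemma mixture_mean j : E (mixture j) = 0.
Proof.
rewrite /mixture E_D; [|by apply: L1Z; exact: cL1|by apply: L1Z; exact: cL1].
by rewrite !E_Z; [rewrite !cmean !mulr0 addr0|exact: cL1|exact: cL1].
Qed.

Lemma md_mixture : md mixture.
Proof.
apply: (md_of_pair X_indep (phi := fun p => g * p.1 + (1 - g) * p.2)).
- apply: measurable_funD; apply: measurable_funM => //.
- exact: L1_mixture_sqr.
- exact: mixture_mean.
Qed.

Lemma md_mixture_sqr : md (fun k w => mixture k w ^+ 2 - v).
Proof.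
apply: (md_of_pair X_indep (phi := fun p => (g * p.1 + (1 - g) * p.2) ^+ 2 - v)).
- apply: measurable_funB => //; apply: measurable_funX.
  by apply: measurable_funD; apply: measurable_funM.
- move=> k; have := L1D (L1B (L1_mixture4 k) (L1Z (2 * v) (L1_mixture_sqr k))) (L1_cst P (v ^+ 2)).
  congr (L1 P _); apply/funext => w.
  have -> : `|mixture k w| ^+ 4 = (mixture k w ^+ 2) ^+ 2.
    by rewrite -(real_normK (num_real (mixture k w))) -exprM.
  by rewrite -/(mixture k w); ring.
- move=> k; rewrite -[LHS]/(E (fun w => mixture k w ^+ 2 - v)).
  rewrite E_B; [|exact: L1_mixture_sqr|exact: L1_cst].
  by rewrite mixture_variance E_cst subrr.
Qed.

End Mixture.

End CommonMeanCLT.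

Lemma probability_setU_le (d : measure_display) (T : measurableType d) (R : realType)
    (P : probability T R) (B C : set T) (b c : R) :
  measurable B -> measurable C -> (P B <= b%:E)%E -> (P C <= c%:E)%E ->
  measurable (B `|` C) /\ (P (B `|` C) <= (b + c)%:E)%E.
Proof.
move=> mB mC Bb Cc; split; first exact: measurableU.
by rewrite EFinD (le_trans (measureU2 _ mB mC))// leeD.
Qed.

(** A crude bound at scale sqrt n, with [L] large enough to make the exceptional set small. The
    range up to 2n covers every window [n, n (1 + k)] with k <= 1. *)
Lemma md_bounded_sums (d : measure_display) (T : measurableType d) (R : realType)
    (P : probability T R) (G : nat -> set (set T)) (Y : nat -> T -> R) (v L eta q : R) n :
  martingale_difference P G Y ->
  (forall k, Rintegral P setT (fun w => Y k w ^+ 2) <= v) ->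
  0 < L -> 2 * v <= eta * L ^+ 2 -> 0 < q -> q ^+ 2 = n%:R ->
  exists B : set T, [/\ measurable B, (P B <= eta%:E)%E &
    forall w, ~ B w -> forall m, (m <= 2 * n)%N -> `|\sum_(j < m) Y j w| <= L * q].
Proof.
move=> mdY Yv L0 vL q0 qn.
have [B [mB PB hB]] := kolmogorov_maximal mdY Yv 0 (2 * n) (mulr_gt0 L0 q0).
exists B; split => //; last by move=> w Bw m mn; exact/ltW/hB.
apply: (le_trans PB); rewrite lee_fin natrM -qn ler_pdivrMr ?exprn_gt0 ?mulr_gt0//.
by rewrite exprMn mulrAC [leRHS]mulrA ler_pM2r// exprn_gt0.
Qed.

(** * The estimator at a random index *)

Section RandomCLT.
Context {d : measure_display} {T : measurableType d} {R : realType}.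
Variables (P : probability T R) (X : 'I_2 -> nat -> {RV P >-> R}).
Variables (mu : R) (sigma : 'I_2 -> R).
Hypothesis X_indep : mutually_independent (fun ij : 'I_2 * nat => X ij.1 ij.2).
Hypothesis X_id : forall i, identically_distributed (X i).
Hypothesis X_mean : forall i, ('E_P[X i 0%N] = mu%:E)%E.
Hypothesis X_var : forall i, ('V_P[X i 0%N] = (sigma i ^+ 2)%:E)%E.
Hypothesis X_moment : forall i, ('E_P[fun w => (`|X i 0%N w| ^+ 12)%R] < +oo)%E.
Variables (gle ggt : 'rV[R]_4 -> R).
Hypothesis cle : continuous gle.
Hypothesis cgt : continuous ggt.
Hypothesis tie : sigma 0 ^+ 2 = sigma 1 ^+ 2 ->
  gle (row4 (sigma 0 ^+ 2) (sigma 1 ^+ 2) mu mu) =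
  ggt (row4 (sigma 0 ^+ 2) (sigma 1 ^+ 2) mu mu).
Hypothesis variance_pos : 0 < asymptotic_variance gle ggt mu (sigma 0) (sigma 1).

Let v := asymptotic_variance gle ggt mu (sigma 0) (sigma 1).
Let sg := Num.sqrt v.
Let g := weight gle ggt (sigma 0 ^+ 2) (sigma 1 ^+ 2) mu mu.
Let est := common_mean gle ggt (fun j => X 0 j) (fun j => X 1 j).
Let Y := mixture X mu g.

Let sg0 : 0 < sg. Proof. by rewrite sqrtr_gt0. Qed.
Let sg2 : sg ^+ 2 = v. Proof. by rewrite sqr_sqrtr// ltW. Qed.
Let vE : v = g ^+ 2 * sigma 0 ^+ 2 + (1 - g) ^+ 2 * sigma 1 ^+ 2. Proof. by []. Qed.

Lemma estimator_anscombe (delta eta : R) : 0 < delta -> 0 < eta ->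
  exists (k : R) N, 0 < k <= 1 /\
   forall n, (N <= n)%N -> exists B, [/\ measurable B, (P B <= eta%:E)%E &
     forall w, ~ B w -> forall m, (n <= m)%N -> m%:R <= n%:R * (1 + k) ->
       `|Num.sqrt m%:R * (est m w - mu) / sg -
         (sg * Num.sqrt n%:R)^-1 * \sum_(j < n) Y j w| <= delta].
Proof.
move=> delta0 eta0.
(* There are five exceptional events: one for the centred sums and one for the square deviations of
   each sample, and one for the increments of the sums of [Y]. *)
pose e5 := eta / 5; have e50 : 0 < e5 by rewrite divr_gt0.
pose vd i := Rintegral P setT (fun w => square_dev X mu sigma i 0 w ^+ 2).
have vd0 i : 0 <= vd i by apply: Rintegral_ge0 => w _; exact: sqr_ge0.
pose V := sigma 0 ^+ 2 + sigma 1 ^+ 2 + vd 0 + vd 1.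
have s0 i : 0 <= sigma i ^+ 2 by exact: sqr_ge0.
have V0 : 0 <= V by rewrite /V !addr_ge0.
(* (1 + x)^2 >= x with x = 2V/e5 yields the variance condition of [md_bounded_sums]. *)
pose L := 1 + 2 * V / e5.
have VL : 2 * V <= e5 * L ^+ 2.
  have h : 0 <= 2 * V / e5 by apply: divr_ge0; [exact: mulr_ge0|exact: ltW].
  have -> : 2 * V = e5 * (2 * V / e5) by field; rewrite gt_eqF.
  rewrite ler_pM2l// /L; nra.
have L_ge1 : 1 <= L by rewrite /L lerDl; apply: divr_ge0; [exact: mulr_ge0|exact: ltW].
have L0 : 0 < L by lra.
pose L' := (`|g| + `|1 - g|) * L.
have L'0 : 0 <= L' by apply: mulr_ge0; [exact: addr_ge0|exact: ltW].
(* The three errors of [estimator_close], namely [d1], [2 * L * d2] and [L' * k], are each allotted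
   [sg * delta / 3]. *)
pose d1 := sg * delta / 3; have d10 : 0 < d1 by rewrite /d1 divr_gt0// mulr_gt0.
pose d2 := sg * delta / (6 * L); have d20 : 0 < d2 by rewrite /d2 divr_gt0// mulr_gt0.
have [rho rho0 hrho] := weight_close cle cgt tie d20.
(* The three bounds serve, in order, to keep the window below 2n, to control the change of
   normalization, and to make the maximal inequality for the increments of [Y] give probability at
   most [e5]. *)
pose k := Num.min 1 (Num.min (sg * delta / (3 * (L' + 1))) (e5 * d1 ^+ 2 / v)).
have k0 : 0 < k.
  by rewrite /k !lt_min ltr01 !divr_gt0 ?mulr_gt0 ?exprn_gt0//; lra.
have k1 : k <= 1 by rewrite /k ge_min lexx.
have k2 : L' * k <= sg * delta / 3.
  have : k <= sg * delta / (3 * (L' + 1)) by rewrite /k !ge_min lexx !orbT.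
  have L'1 : 0 < L' + 1 by lra.
  rewrite ler_pdivlMr ?mulr_gt0// => h.
  have : 0 <= k * 3 by rewrite mulr_ge0// ltW.
  have kE : k * (3 * (L' + 1)) = 3 * (L' * k) + k * 3 by ring.
  rewrite kE in h.
  lra.
have k3 : k * v <= e5 * d1 ^+ 2.
  by rewrite -ler_pdivlMr// /k !ge_min lexx !orbT.
(* Once sqrt n exceeds [M], the size conditions of [sample_mean_close] and [sample_variance_close]
   hold for both samples at once. *)
pose M := 2 + 2 * (L + sigma 0 ^+ 2 + sigma 1 ^+ 2 + L ^+ 2) / rho.
have M2 : 2 <= M.
  rewrite lerDl; apply: divr_ge0; last exact: ltW.
  by apply: mulr_ge0 => //; have := s0 0; have := s0 1; have := sqr_ge0 L; lra.
have [N hN] : exists N : nat, forall n, (N <= n)%N -> M < Num.sqrt n%:R.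
  exists (Num.truncn (M ^+ 2)).+1 => n nN.
  have -> : M = Num.sqrt (M ^+ 2) by rewrite sqrtr_sqr ger0_norm//; lra.
  rewrite ltr_sqrt; last by rewrite ltr0n (leq_trans _ nN).
  by rewrite (lt_le_trans (truncnS_gt _))// ler_nat.
exists k, N; split; first by rewrite k0 k1.
move=> n /hN; set q := Num.sqrt n%:R => Mq.
have q0 : 0 < q by lra.
have qn : q ^+ 2 = n%:R by rewrite sqr_sqrtr.
have n0 : (0 < n)%N by rewrite -(ltr0n R) -qn exprn_gt0.
have Vc i : sigma i ^+ 2 <= V.
  by rewrite /V; elim/ord2P: i; have := s0 0; have := s0 1; have := vd0 0; have := vd0 1; lra.
have Vd i : vd i <= V.
  by rewrite /V; elim/ord2P: i; have := s0 0; have := s0 1; have := vd0 0; have := vd0 1; lra.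
have hc i : exists B : set T, [/\ measurable B, (P B <= e5%:E)%E &
    forall w, ~ B w -> forall m, (m <= 2 * n)%N -> `|\sum_(j < m) centered X mu i j w| <= L * q].
  apply: (md_bounded_sums (v := V) (md_centered X_indep X_id X_mean X_moment i)) => //.
  by move=> j; rewrite (centered_variance X_id X_mean X_var X_moment).
have hd i : exists B : set T, [/\ measurable B, (P B <= e5%:E)%E &
    forall w, ~ B w -> forall m, (m <= 2 * n)%N ->
      `|\sum_(j < m) square_dev X mu sigma i j w| <= L * q].
  apply: (md_bounded_sums (v := V) (md_square_dev X_indep X_id X_mean X_var X_moment i)) => //.
  by move=> j; rewrite (square_dev_variance _ _ X_id X_moment); exact: Vd.
have [B1 [mB1 PB1 hB1]] := hc 0; have [B2 [mB2 PB2 hB2]] := hc 1.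
have [B3 [mB3 PB3 hB3]] := hd 0; have [B4 [mB4 PB4 hB4]] := hd 1.
have Yv j : Rintegral P setT (fun w => Y j w ^+ 2) <= v.
  by rewrite (mixture_variance X_indep X_id X_mean X_var X_moment vE).
have mdY := md_mixture X_indep X_id X_mean X_moment g.
pose c := Num.truncn (n%:R * k).
have [B5 [mB5 PB5 hB5]] := kolmogorov_maximal mdY Yv n c (mulr_gt0 d10 q0).
have kn0 : 0 <= n%:R * k by rewrite mulr_ge0// ltW.
have /andP[cn nc] := truncn_itv kn0.
have PB5' : (P B5 <= e5%:E)%E.
  apply: (le_trans PB5); rewrite lee_fin ler_pdivrMr ?exprn_gt0 ?mulr_gt0//.
  apply: (@le_trans _ _ (n%:R * k * v)); first by rewrite ler_pM2r.
  rewrite exprMn qn -mulrA mulrA [leRHS]mulrA -[leLHS]mulrA mulrC.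
  by rewrite ler_pM2r// ltr0n.
have [mU1 PU1] := probability_setU_le mB1 mB2 PB1 PB2.
have [mU2 PU2] := probability_setU_le mU1 mB3 PU1 PB3.
have [mU3 PU3] := probability_setU_le mU2 mB4 PU2 PB4.
have [mU4 PU4] := probability_setU_le mU3 mB5 PU3 PB5'.
exists (B1 `|` B2 `|` B3 `|` B4 `|` B5); split => //.
  by apply: (le_trans PU4); rewrite lee_fin /e5; lra.
move=> w Bw m nm mk.
have w1 : ~ B1 w by move=> h; apply: Bw; do 4 left.
have w2 : ~ B2 w by move=> h; apply: Bw; do 3 left; right.
have w3 : ~ B3 w by move=> h; apply: Bw; do 2 left; right.
have w4 : ~ B4 w by move=> h; apply: Bw; left; right.
have w5 : ~ B5 w by move=> h; apply: Bw; right.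
have n2 : (n <= 2 * n)%N by rewrite leq_pmull.
have m2 : (m <= 2 * n)%N.
  rewrite -(ler_nat R) (le_trans mk)// natrM mulrC ler_pM2r ?ltr0n//; lra.
have m0 : (0 < m)%N := leq_trans n0 nm.
set r := Num.sqrt m%:R.
have rm : r ^+ 2 = m%:R by rewrite sqr_sqrtr.
have qr : q <= r by rewrite ler_wsqrtr// ler_nat.
have hL : 2 * (L + sigma 0 ^+ 2 + sigma 1 ^+ 2 + L ^+ 2) < rho * q.
  have : 2 * (L + sigma 0 ^+ 2 + sigma 1 ^+ 2 + L ^+ 2) / rho < q by rewrite /M in Mq; lra.
  by rewrite ltr_pdivrMr// (mulrC q).
have L20 : 0 <= L ^+ 2 by exact: sqr_ge0.
have s10 := s0 1; have s00 := s0 0.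
have hLa : 2 * (L + sigma 0 ^+ 2 + L ^+ 2) < rho * q by lra.
have hLb : 2 * (L + sigma 1 ^+ 2 + L ^+ 2) < rho * q by lra.
have hLm : L < rho * q by lra.
have q2 : 2 <= q by lra.
have L0' := ltW L0.
have hw : `|weight gle ggt (sample_variance (fun j => X 0 j) m w)
    (sample_variance (fun j => X 1 j) m w) (sample_mean (fun j => X 0 j) m w)
    (sample_mean (fun j => X 1 j) m w) - g| <= d2.
  apply: hrho.
  - exact: (sample_variance_close L0' s00 q2 qn nm (hB1 w w1 m m2) (hB3 w w3 m m2) hLa).
  - exact: (sample_variance_close L0' s10 q2 qn nm (hB2 w w2 m m2) (hB4 w w4 m m2) hLb).
  - exact: (sample_mean_close L0' q0 qn nm (hB1 w w1 m m2) hLm).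
  - exact: (sample_mean_close L0' q0 qn nm (hB2 w w2 m m2) hLm).
have sumY p : \sum_(j < p) Y j w =
    g * (\sum_(j < p) centered X mu 0 j w) + (1 - g) * (\sum_(j < p) centered X mu 1 j w).
  by rewrite !mulr_sumr -big_split /=; exact: eq_bigr.
have eE : est m w - mu =
   weight gle ggt (sample_variance (fun j => X 0 j) m w)
    (sample_variance (fun j => X 1 j) m w) (sample_mean (fun j => X 0 j) m w)
    (sample_mean (fun j => X 1 j) m w) * ((\sum_(j < m) centered X mu 0 j w) / r ^+ 2) +
   (1 - weight gle ggt (sample_variance (fun j => X 0 j) m w)
    (sample_variance (fun j => X 1 j) m w) (sample_mean (fun j => X 0 j) m w)
    (sample_mean (fun j => X 1 j) m w)) * ((\sum_(j < m) centered X mu 1 j w) / r ^+ 2).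
  rewrite /est /common_mean; set h := weight _ _ _ _ _ _.
  rewrite !(sample_mean_centered _ mu)// rm /centered; ring.
rewrite eE sumY.
apply: (le_trans (estimator_close (k := k) (L := L) (L' := L') (d1 := d1) (d2 := d2)
  sg0 q0 qr _ _ _ _ _ _ _ _)).
- by rewrite rm qn.
- exact: ltW.
- exact: ltW.
- exact: hB1.
- exact: hB2.
- rewrite (le_trans (ler_normD _ _))// !normrM /L' -mulrA mulrDl.
  by apply: lerD; rewrite ler_wpM2l//; [exact: hB1|exact: hB2].
- rewrite -!sumY -(subnKC nm) big_split_ord /= addrAC subrr add0r.
  apply: ltW; apply: hB5 => //.
  rewrite /c truncn_ge_nat// natrB//; lra.
- exact: hw.
rewrite ler_pdivrMr//.
have -> : 2 * L * d2 = sg * delta / 3 by rewrite /d2; field; rewrite gt_eqF.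
by rewrite /d1; lra.
Qed.

Lemma estimator_random_clt : random_clt P est mu sg.
Proof.
have mY := measurable_mixture X mu g.
have mest m : measurable_fun setT (est m).
  by apply: measurable_common_mean.
move=> c tau c0 itau cv.
apply: (anscombe (W := fun n w => (sg * Num.sqrt n%:R)^-1 * \sum_(j < n) Y j w)
  (Q := fun m w => Num.sqrt m%:R * (est m w - mu) / sg) (c := c) (tau := tau)) => //.
- move=> n; apply: measurable_funM => //.
  by apply: measurable_sum => j; exact: mY.
- exact: estimator_anscombe.
- move=> x e eta e0 eta0.
  have mdY := md_mixture X_indep X_id X_mean X_moment g.
  have mdY2 := md_mixture_sqr X_indep X_id X_mean X_var X_moment vE.
  rewrite -sg2 in mdY2.
  exact: (md_clt sg0 mdY mdY2 (fun k => L1_mixture_expr mu X_id X_moment g k (isT : (3 <= 4)%N))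
    (mixture_moment3 mu X_id X_moment g) x e0 eta0).
- move=> a a0 _ A mA; rewrite setTI.
  apply: (@measurable_integer_rv _ _ (tau a)
    (fun i => [set w | A (Num.sqrt i%:~R * (est (absz i) w - mu) / sg)])).
    exact: itau.
  move=> i; rewrite -[X in measurable X]setTI.
  have : measurable_fun setT (fun w => Num.sqrt i%:~R * (est `|i|%N w - mu) / sg).
    apply: measurable_funM => //; apply: measurable_funM => //.
    exact: measurable_funB.
  by apply.
- move=> a w t0; congr (Num.sqrt _ * _ / _).
  by rewrite -[in LHS](gtz0_abs t0).
Qed.

End RandomCLT.

(** A stopping time is in particular an integer-valued random variable: the event N = n is the
    difference of N <= n and N < n, which lie in the filtration and hence are measurable. *)
Lemma random_clt_condition_A (d : measure_display) (T : measurableType d) (R : realType)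
    (P : probability T R) (est : nat -> T -> R) (mu sigma : R) :
  random_clt P est mu sigma -> condition_A P est mu sigma.
Proof.
move=> clt F k N [_ Fm _] k0 stN cvN.
apply: (clt k (fun a w => Posz (N a w)) k0) => // a a0 i.
case: i => [n|n]; last first.
  by rewrite (_ : [set _ | _] = set0)//; apply/seteqP; split => // w.
have m j : measurable [set w | (N a w <= j)%N] by apply: Fm; exact: stN.
rewrite (_ : [set _ | _] = [set w | (N a w <= n)%N] `\` [set w | (N a w < n)%N]).
  apply: measurableD; first exact: m.
  case: n => [|n]; last exact: (m n).
  by rewrite (_ : [set _ | _] = set0)//; apply/seteqP; split => // w.
apply/seteqP; split => w /=.
  by move=> [->]; rewrite leqnn ltnn.
by move=> [h1 /negP]; rewrite -leqNgt => h2; congr Posz; apply/eqP; rewrite eqn_leq h1.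
Qed.

(** [weight_tie] concerns equal variances, where the order of the sample variances need not settle
    and both branches must lead to one limiting weight. [variance_pos] gives the division by
    [sigma_mu] its meaning. *)
Theorem theorem4p3 (R : realType) (d : measure_display) (T : measurableType d)
    (P : probability T R)
    (X : 'I_2 -> nat -> {RV P >-> R}) (mu : R) (sigma : 'I_2 -> R)
    (gle ggt : 'rV[R]_4 -> R)
    (X_indep : mutually_independent (fun ij : 'I_2 * nat => X ij.1 ij.2))
    (X_id : forall i, identically_distributed (X i))
    (X_mean : forall i, ('E_P[X i 0%N] = mu%:E)%E)
    (X_var : forall i, ('V_P[X i 0%N] = (sigma i ^+ 2)%:E)%E)
    (X_moment : forall i, ('E_P[fun w => (`|X i 0%N w| ^+ 12)%R] < +oo)%E)
    (gle_C3 : cont_diff 3 gle) (gle_bounded : bounded_derivatives 3 gle)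
    (ggt_C3 : cont_diff 3 ggt) (ggt_bounded : bounded_derivatives 3 ggt)
    (weight_tie : sigma 0 ^+ 2 = sigma 1 ^+ 2 ->
       gle (row4 (sigma 0 ^+ 2) (sigma 1 ^+ 2) mu mu) =
       ggt (row4 (sigma 0 ^+ 2) (sigma 1 ^+ 2) mu mu))
    (variance_pos : 0 < asymptotic_variance gle ggt mu (sigma 0) (sigma 1)) :
  let sigma_mu := Num.sqrt (asymptotic_variance gle ggt mu (sigma 0) (sigma 1)) in
  let est := common_mean gle ggt (fun j => X 0 j) (fun j => X 1 j) in
  random_clt P est mu sigma_mu /\ condition_A P est mu sigma_mu.
Proof.
move=> sigma_mu est.
have clt : random_clt P est mu sigma_mu.
  exact: (estimator_random_clt X_indep X_id X_mean X_var X_moment gle_C3.1 ggt_C3.1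
            weight_tie variance_pos).
by split => //; exact: random_clt_condition_A.
Qed.
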